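(* Let $k$ be a finite field with $q_k$ elements and let $\mathcal T$ be a skeletally small and idempotent complete triangulated $k$-category with shift $T$, which is finitary, 2-periodic (i.e. $T^2\cong1$) and has proper Grothendieck group. Let $\mathfrak g=\mathfrak h\oplus\mathfrak n$ with its bracket, the subgroup $\mathfrak g_1=\mathfrak h_1\oplus\mathfrak n$, and the bilinear form $(\,\cdot\mid\cdot\,)$ on $\mathfrak g\times\mathfrak g_1$ be as defined in the context. Then this form is invariant modulo $q_k-1$ in the sense that for all indecomposable objects $X,Y,Z$, $$(\tilde h_X\mid[u_Y,u_Z])\,d(Z)\equiv-([\tilde h_X,u_Y]\mid u_Z)\mod(q_k-1)$$ and $$d(X)\,([u_X,u_Y]\mid u_Z)\equiv(u_X\mid[u_Y,u_Z])\,d(Z)\mod(q_k-1),$$ where $(a\mid[u_Y,u_Z])\,d(Z)$ means $(a\mid d(Z)[u_Y,u_Z])$, with $d(Z)[u_Y,u_Z]\in\mathfrak g_1$.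
   Context: Grothendieck group: $\mathcal G$ is the quotient of the free abelian group on the isomorphism classes $[X]$ of objects of $\mathcal T$ by the relations $[X]+[Y]-[L]$ whenever there is an exact triangle $Y\to L\to X\to TY$; $h_X$ is the image of $[X]$. $\mathcal G$ is proper if $h_X\neq0$ in $\mathcal G$ for every indecomposable $X$. $\mathcal T$ is finitary if all homomorphism spaces are finite sets and, for each $h\in\mathcal G$, there are only finitely many isomorphism classes of indecomposable objects $X$ (up to shift) with $h_X=h$. For $X$ indecomposable, $d(X):=\dim_k(\operatorname{End}X/\operatorname{rad}\operatorname{End}X)$. $W_{XY}^L$ is the set of all exact triangles $Y\xrightarrow{f}L\xrightarrow{g}X\xrightarrow{h}TY$ (triples $(f,g,h)$ for fixed $X,Y,L$). The group $\operatorname{Aut}X\times\operatorname{Aut}Y$ acts on it by $(\xi,\eta)\cdot(f,g,h)=(f\eta^{-1},\xi g,(T\eta)h\xi^{-1})$, and $F_{XY}^L$ is the number of orbits. For $X$ indecomposable put $\tilde h_X:=h_X/d(X)\in\mathbb Q\otimes_{\mathbb Z}\mathcal G$. Let $\mathfrak h$ be the subgroup of $\mathbb Q\otimes_{\mathbb Z}\mathcal G$ generated by all $\tilde h_X$, and $\mathfrak h_1\subseteq\mathfrak h$ the subgroup generated by all $h_X$ ($X$ indecomposable). A bilinear form is determined by $$(h_X\mid h_Y)=\dim\operatorname{Hom}(X,Y)-\dim\operatorname{Hom}(X,TY)+\dim\operatorname{Hom}(Y,X)-\dim\operatorname{Hom}(Y,TX);$$ it takes integer values on $\mathfrak h\times\mathfrak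 h_1$. $\mathfrak n$ is the free abelian group with basis $u_X=u_{[X]}$ indexed by isomorphism classes of indecomposable objects. Set $\mathfrak g:=\mathfrak h\oplus\mathfrak n$ and $\mathfrak g_1:=\mathfrak h_1\oplus\mathfrak n$. The bracket on $\mathfrak g$ is bilinear with, for $X,Y$ indecomposable, $$[u_X,u_Y]:=\begin{cases}\sum_{[L],\,L\text{ indecomposable}}(F_{XY}^L-F_{YX}^L)u_L&\text{if }X\not\cong TY,\\ \tilde h_X&\text{if }X\cong TY,\end{cases}$$ $$[\tilde h_X,u_Y]:=-(\tilde h_X\mid h_Y)u_Y,\quad [u_Y,\tilde h_X]:=(\tilde h_X\mid h_Y)u_Y,\quad [\tilde h_X,\tilde h_Y]:=0.$$ The form on $\mathfrak h\times\mathfrak h_1$ is extended bilinearly to $\mathfrak g\times\mathfrak g_1$ by letting $\mathfrak h$ and $\mathfrak n$ be orthogonal ($(\tilde h_X\mid u_Y):=0$, and likewise $(u_Y\mid h_X):=0$) and $(u_X\mid u_Y):=1$ if $X\cong TY$, and $0$ otherwise. *)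

(* Defs.v *)
From HB Require Import structures.
From mathcomp Require Import all_boot all_order all_algebra.
From mathcomp Require Import finmap generic_quotient ring_quotient.
From mathcomp Require Import all_classical.
From mathcomp Require Import freeg.

Set Implicit Arguments.
Unset Strict Implicit.
Unset Printing Implicit Defensive.

Import Order.TTheory GRing.Theory Num.Theory.
Local Open Scope classical_set_scope.
Local Open Scope ring_scope.
Local Open Scope quotient_scope.

(** * Abelian groups: generated subgroups, quotients, tensor products *)

Definition gen_subgrp (V : zmodType) (S : set V) : {pred V} :=
  fun x => `[< forall P : set V, P 0 -> (forall a b, P a -> P b -> P (a - b)) ->
               S `<=` P -> P x >].

Lemma gen_zmod_closed (V : zmodType) (S : set V) : zmod_closed (gen_subgrp S).
Proof.
split=> [|x y /asboolP Hx /asboolP Hy]; apply/asboolP=> P P0 PB SP //.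
exact: PB (Hx P P0 PB SP) (Hy P P0 PB SP).
Qed.

HB.instance Definition _ (V : zmodType) (S : set V) :=
  GRing.isZmodClosed.Build V (gen_subgrp S) (gen_zmod_closed S).

Lemma mem_gen_subgrp (V : zmodType) (S : set V) x : S x -> x \in gen_subgrp S.
Proof. by move=> Sx; apply/asboolP=> P _ _; apply. Qed.

Record subgrp (V : zmodType) (S : set V) :=
  Subgrp { subgrp_val :> V; subgrpP : subgrp_val \in gen_subgrp S }.
HB.instance Definition _ (V : zmodType) (S : set V) :=
  [isSub for @subgrp_val V S].
HB.instance Definition _ (V : zmodType) (S : set V) :=
  [Choice of subgrp S by <:].
HB.instance Definition _ (V : zmodType) (S : set V) :=
  [SubChoice_isSubZmodule of subgrp S by <:].

Definition quotgrp (V : zmodType) (S : set V) := Quotient.quot (gen_subgrp S).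
HB.instance Definition _ (V : zmodType) (S : set V) :=
  GRing.Zmodule.on (quotgrp S).

Definition quotpi (V : zmodType) (S : set V) (x : V) : quotgrp S :=
  \pi_(Quotient.quot (gen_subgrp S)) x.

Definition tensor_rel (A B : zmodType) : set {freeg (A * B)%type} :=
  [set r | (exists a a' b, r = << (a + a', b) >> - << (a, b) >> - << (a', b) >>)
        \/ (exists a b b', r = << (a, b + b') >> - << (a, b) >> - << (a, b') >>)].

Definition tensor (A B : zmodType) := quotgrp (@tensor_rel A B).
HB.instance Definition _ (A B : zmodType) := GRing.Zmodule.on (tensor A B).

Definition tens (A B : zmodType) (a : A) (b : B) : tensor A B :=
  quotpi _ << (a, b) >>.

(* The biadditive extension of [phi] to free abelian groups. *)
Definition bilift (I J : choiceType) (V : zmodType) (phi : I -> J -> V)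
    (m : {freeg I}) (n : {freeg J}) : V :=
  \sum_(i <- dom m) \sum_(j <- dom n) phi i j *~ (coeff i m * coeff j n).

Definition biadditive (U V W : zmodType) (b : U -> V -> W) : Prop :=
  (forall x x' y, b (x + x') y = b x y + b x' y) /\
  (forall x y y', b x (y + y') = b x y + b x y').

(** * Dimensions *)

(* [n] such that [V / W] is isomorphic to [k^n] (0 if there is none), for a
   linear subspace [W] of [V]. *)
Definition quotdim (k : fieldType) (V : lmodType k) (W : set V) : nat :=
  xget 0%N [set n | exists f : {linear V -> 'rV[k]_n},
                      (forall y, exists x, f x = y) /\
                      (forall x, f x = 0 <-> W x)].

Definition dimk (k : fieldType) (V : lmodType k) : nat := quotdim [set (0 : V)].

(** * Linear categories *)

(* Objects form a type, hence so do their isomorphism classes ([isoClass]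
   below): skeletal smallness is built in.  Hom-spaces are arbitrary vector
   spaces. *)
Record linCat (k : fieldType) := LinCat {
  obj :> Type;
  homk : obj -> obj -> lmodType k;
  idhom : forall X, homk X X;
  compm : forall X Y Z, homk Y Z -> homk X Y -> homk X Z;
  compmA : forall X Y Z U (h : homk Z U) (g : homk Y Z) (f : homk X Y),
    compm h (compm g f) = compm (compm h g) f;
  comp1m : forall X Y (f : homk X Y), compm (idhom Y) f = f;
  compm1 : forall X Y (f : homk X Y), compm f (idhom X) = f;
  comp_linl : forall X Y Z (f : homk X Y), linear (fun g : homk Y Z => compm g f);
  comp_linr : forall X Y Z (g : homk Y Z), linear (fun f : homk X Y => compm g f)
}.

Arguments homk {k} _ _ _ : rename.
Arguments idhom {k C} X : rename.
Arguments compm {k C X Y Z} g f : rename.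
Notation "g '\oc' f" := (compm g f) (at level 40, left associativity).

Section LinCat.
Variables (k : fieldType) (C : linCat k).

Definition inverse_of (X Y : C) (f : homk C X Y) (g : homk C Y X) : Prop :=
  g \oc f = idhom X /\ f \oc g = idhom Y.

Definition is_isom (X Y : C) (f : homk C X Y) : Prop := exists g, inverse_of f g.

Definition iso (X Y : C) : Prop := exists f : homk C X Y, is_isom f.

Definition is_zero (X : C) : Prop :=
  forall Y, (forall f : homk C X Y, f = 0) /\ (forall f : homk C Y X, f = 0).

Definition is_biproduct (A B P : C) : Prop :=
  exists (i1 : homk C A P) (i2 : homk C B P) (p1 : homk C P A) (p2 : homk C P B),
    [/\ p1 \oc i1 = idhom A, p2 \oc i2 = idhom B, p1 \oc i2 = 0, p2 \oc i1 = 0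
      & i1 \oc p1 + i2 \oc p2 = idhom P].

Definition indecomposable (X : C) : Prop :=
  ~ is_zero X /\ forall A B, is_biproduct A B X -> is_zero A \/ is_zero B.

Definition idempotent_complete : Prop :=
  forall (X : C) (e : homk C X X), e \oc e = e ->
    exists (Y : C) (p : homk C X Y) (i : homk C Y X), p \oc i = idhom Y /\ i \oc p = e.

(** The Jacobson radical of [End X]: the intersection of its maximal left
    ideals. *)

Definition left_ideal (X : C) (I : set (homk C X X)) : Prop :=
  [/\ I 0, forall a b, I a -> I b -> I (a - b) & forall a b, I b -> I (a \oc b)].

Definition max_left_ideal (X : C) (I : set (homk C X X)) : Prop :=
  [/\ left_ideal I, ~ I (idhom X) &
      forall J, left_ideal J -> I `<=` J -> ~ J (idhom X) -> J = I].

Definition rad_end (X : C) : set (homk C X X) :=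
  [set f | forall I, max_left_ideal I -> I f].

Definition dEnd (X : C) : nat := quotdim (@rad_end X).

(** Isomorphism classes of objects and of indecomposable objects *)

Lemma iso_refl (X : C) : iso X X.
Proof. by exists (idhom X), (idhom X); split; rewrite comp1m. Qed.

Lemma iso_sym (X Y : C) : iso X Y -> iso Y X.
Proof. by case=> f [g [gf fg]]; exists g, f; split. Qed.

Lemma iso_trans (Y X Z : C) : iso X Y -> iso Y Z -> iso X Z.
Proof.
case=> f [f' [f'f ff']] [g [g' [g'g gg']]]; exists (g \oc f), (f' \oc g').
split; first by rewrite -compmA (compmA g' g f) g'g comp1m.
by rewrite -compmA (compmA f f' g') ff' comp1m.
Qed.

Definition iso_rel : rel {classic C} := fun X Y => `[< iso (X : C) Y >].

Lemma iso_rel_equiv : equiv_class_of iso_rel.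
Proof.
split=> [X|X Y|Y X Z]; first exact/asboolP/iso_refl.
- by apply/asboolP/asboolP => /iso_sym.
- by move=> /asboolP XY /asboolP YZ; apply/asboolP/(iso_trans XY).
Qed.

Canonical iso_equiv := EquivRelPack iso_rel_equiv.

Definition isoClass := {eq_quot iso_rel}.
HB.instance Definition _ := Choice.on isoClass.

Definition isocls (X : C) : isoClass := \pi_({eq_quot iso_rel}) (X : {classic C}).

Record indObj := IndObj { ind_obj :> obj C; ind_objP : indecomposable ind_obj }.
HB.instance Definition _ := gen_eqMixin indObj.
HB.instance Definition _ := gen_choiceMixin indObj.

Definition ind_rel : rel indObj := fun X Y => iso_rel (X : C) (Y : C).

Lemma ind_rel_equiv : equiv_class_of ind_rel.
Proof.
by split=> [X|X Y|Y X Z]; [exact: equiv_refl|exact: equiv_sym|exact: equiv_trans].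
Qed.

Canonical ind_equiv := EquivRelPack ind_rel_equiv.

Definition indClass := {eq_quot ind_rel}.
HB.instance Definition _ := Choice.on indClass.

Definition indcls (X : indObj) : indClass := \pi_({eq_quot ind_rel}) X.
Definition indrepr (c : indClass) : indObj := repr (c : {eq_quot ind_rel}).

End LinCat.

(** * Triangulated categories *)

Record triCat (k : fieldType) := TriCat {
  tcat :> linCat k;
  (* additive category *)
  has_zero : exists O : tcat, is_zero O;
  has_biproducts : forall A B : tcat, exists P, is_biproduct A B P;
  (* the shift, a k-linear auto-equivalence *)
  shob : tcat -> tcat;
  shm : forall X Y, {linear homk tcat X Y -> homk tcat (shob X) (shob Y)};
  shm_id : forall X, shm X X (idhom X) = idhom (shob X);
  shm_comp : forall X Y Z (g : homk tcat Y Z) (f : homk tcat X Y),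
    shm X Z (g \oc f) = shm Y Z g \oc shm X Y f;
  shm_bij : forall X Y, bijective (shm X Y);
  sh_esssurj : forall Y, exists X, iso (shob X) Y;
  (* [exact_tri f g h]: the triangle X -f-> Y -g-> Z -h-> TX is exact *)
  exact_tri : forall X Y Z,
    homk tcat X Y -> homk tcat Y Z -> homk tcat Z (shob X) -> Prop;
  (* TR1 *)
  exact_iso : forall X Y Z X' Y' Z'
      (f : homk tcat X Y) (g : homk tcat Y Z) (h : homk tcat Z (shob X))
      (f' : homk tcat X' Y') (g' : homk tcat Y' Z') (h' : homk tcat Z' (shob X'))
      (a : homk tcat X X') (b : homk tcat Y Y') (c : homk tcat Z Z'),
    is_isom a -> is_isom b -> is_isom c ->
    b \oc f = f' \oc a -> c \oc g = g' \oc b -> shm X X' a \oc h = h' \oc c ->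
    exact_tri f g h -> exact_tri f' g' h';
  exact_id : forall X O : tcat, is_zero O ->
    exact_tri (idhom X) (0 : homk tcat X O) (0 : homk tcat O (shob X));
  exact_cone : forall X Y (f : homk tcat X Y),
    exists (Z : tcat) (g : homk tcat Y Z) (h : homk tcat Z (shob X)), exact_tri f g h;
  (* TR2 *)
  exact_rot : forall X Y Z
      (f : homk tcat X Y) (g : homk tcat Y Z) (h : homk tcat Z (shob X)),
    exact_tri f g h <-> exact_tri g h (- shm X Y f);
  (* TR3 *)
  exact_mor : forall X Y Z X' Y' Z'
      (f : homk tcat X Y) (g : homk tcat Y Z) (h : homk tcat Z (shob X))
      (f' : homk tcat X' Y') (g' : homk tcat Y' Z') (h' : homk tcat Z' (shob X'))
      (a : homk tcat X X') (b : homk tcat Y Y'),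
    exact_tri f g h -> exact_tri f' g' h' -> b \oc f = f' \oc a ->
    exists c : homk tcat Z Z', c \oc g = g' \oc b /\ shm X X' a \oc h = h' \oc c;
  (* TR4 (octahedral axiom) *)
  exact_oct : forall X Y Z Z' X' Y'
      (f : homk tcat X Y) (j : homk tcat Y Z') (p : homk tcat Z' (shob X))
      (g : homk tcat Y Z) (l : homk tcat Z X') (i : homk tcat X' (shob Y))
      (m : homk tcat Z Y') (n : homk tcat Y' (shob X)),
    exact_tri f j p -> exact_tri g l i -> exact_tri (g \oc f) m n ->
    exists (u : homk tcat Z' Y') (v : homk tcat Y' X'),
      exact_tri u v (shm Y Z' j \oc i) /\
      [/\ u \oc j = m \oc g, n \oc u = p, v \oc m = l & i \oc v = shm X Y f \oc n]
}.

Arguments shob {k T} X : rename.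
Arguments shm {k T X Y} : rename.
Arguments exact_tri {k T X Y Z} f g h : rename.

Section LieAlgebra.
Variables (k : fieldType) (T : triCat k).

Definition two_periodic : Prop :=
  exists s : forall X : T, homk T (shob (shob X)) X,
    (forall X, is_isom (s X)) /\
    (forall X Y (f : homk T X Y), s Y \oc shm (shm f) = f \oc s X).

(** The Grothendieck group *)

Definition groth_rel : set {freeg (isoClass T)} :=
  [set r | exists (X Y L : T) (f : homk T Y L) (g : homk T L X) (h : homk T X (shob Y)),
     exact_tri f g h /\ r = << isocls X >> + << isocls Y >> - << isocls L >>].

Definition groth := quotgrp groth_rel.
HB.instance Definition _ := GRing.Zmodule.on groth.

Definition gcls (X : T) : groth := quotpi _ << isocls X >>.

Definition proper_groth : Prop := forall X : T, indecomposable X -> gcls X <> 0.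

(* [X] and [S i] agree up to shift when [T^a X] and [T^b (S i)] are isomorphic
   for some [a] and [b], the shift being an equivalence. *)
Definition finitary : Prop :=
  (forall X Y : T, finite_set [set: homk T X Y]) /\
  (forall h : groth, exists (N : nat) (S : 'I_N -> T),
     forall X : T, indecomposable X -> gcls X = h ->
       exists i a b, iso (iter a shob X) (iter b shob (S i))).

(** The numbers [F_{XY}^L] *)

Section OrbitNumber.
Variables X Y L : T.

Definition triangles : set (homk T Y L * homk T L X * homk T X (shob Y))%type :=
  [set t | exact_tri t.1.1 t.1.2 t.2].

(* [xi'] and [eta'] are the inverses of the automorphisms [xi] and [eta]. *)
Definition orbit_of (t : homk T Y L * homk T L X * homk T X (shob Y)) :
    set (homk T Y L * homk T L X * homk T X (shob Y))%type :=
  [set t' | exists (xi xi' : homk T X X) (eta eta' : homk T Y Y),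
     [/\ inverse_of xi xi', inverse_of eta eta' &
         t' = (t.1.1 \oc eta', xi \oc t.1.2, shm eta \oc t.2 \oc xi')]].

Definition Fnum : nat := #|` fset_set [set orbit_of t | t in triangles] |.

End OrbitNumber.

(** The groups [h] and [h_1], and the form on [h x h_1] *)

Definition QG := tensor rat groth.
HB.instance Definition _ := GRing.Zmodule.on QG.

Definition hQ (X : T) : QG := tens 1 (gcls X).
Definition htildeQ (X : T) : QG := tens (dEnd X)%:R^-1 (gcls X).

Definition htilde_set : set QG := [set x | exists X : indObj T, x = htildeQ X].
Definition h1_set : set QG := [set x | exists X : indObj T, x = hQ X].

Definition lie_h := subgrp htilde_set.
Definition lie_h1 := subgrp h1_set.
HB.instance Definition _ := GRing.Zmodule.on lie_h.
HB.instance Definition _ := GRing.Zmodule.on lie_h1.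

Definition htilde (X : indObj T) : lie_h :=
  Subgrp (mem_gen_subgrp (ex_intro _ X erefl : htilde_set (htildeQ X))).
Definition h1 (X : indObj T) : lie_h1 :=
  Subgrp (mem_gen_subgrp (ex_intro _ X erefl : h1_set (hQ X))).

Definition dimhom (X Y : T) : rat := (dimk (homk T X Y))%:R.

(* The biadditive form on [Q (x) G] determined by its values on the classes of
   objects; it is unique, and exists when Hom-spaces are finite and [T^2 = 1],
   by the long exact Hom-sequences.  The zero form is a default otherwise. *)
Definition formQ : QG -> QG -> rat :=
  xget (fun _ _ => 0)
    [set b | biadditive b /\
       forall X Y : T, b (hQ X) (hQ Y) =
         dimhom X Y - dimhom X (shob Y) + dimhom Y X - dimhom Y (shob X)].

(* [formQ] takes integer values on [h x h_1], so [floor] is only a cast. *)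
Definition formH (a : lie_h) (b : lie_h1) : int :=
  Num.floor (formQ (subgrp_val a) (subgrp_val b)).

(** The Lie algebra [g = h + n], its subgroup [g_1 = h_1 + n] and the form *)

Definition lie_n := {freeg (indClass T)}.

Definition lie_g := (lie_h * lie_n)%type.
Definition lie_g1 := (lie_h1 * lie_n)%type.

HB.instance Definition _ := GRing.Zmodule.on lie_n.
HB.instance Definition _ := GRing.Zmodule.on lie_g.
HB.instance Definition _ := GRing.Zmodule.on lie_g1.

(* [w] and [x] are the same element of [(Q (x) G) + n]. *)
Definition g1_eq_g (w : lie_g1) (x : lie_g) : Prop :=
  subgrp_val w.1 = subgrp_val x.1 :> QG /\ w.2 = x.2.

(* The values of the bracket on basis elements of [n], by components.  The
   conditions and the numbers [Fnum] do not depend on the representatives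
   [indrepr].  The sum is over the finite support of its summand, and is 0 if
   this support is infinite, which does not happen for finitary 2-periodic
   [T]. *)
Definition brk_h (c e : indClass T) : lie_h :=
  if `[< iso (indrepr c : T) (shob (indrepr e)) >] then htilde (indrepr c) else 0.

Definition brk_n (c e : indClass T) : lie_n :=
  if `[< iso (indrepr c : T) (shob (indrepr e)) >] then 0 else
  let X : T := indrepr c in let Y : T := indrepr e in
  \sum_(l \in [set: indClass T])
     << ((Fnum X Y (indrepr l))%:Z - (Fnum Y X (indrepr l))%:Z) *g l >>.

(* [(a | h_Y) u_Y], extended linearly from [u_Y] to [n]. *)
Definition h_act (a : lie_h) (m : lie_n) : lie_n :=
  \sum_(c <- dom m) << (formH a (h1 (indrepr c)) * coeff c m) *g c >>.

Definition bracket (x y : lie_g) : lie_g :=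
  (bilift brk_h x.2 y.2, bilift brk_n x.2 y.2 - h_act x.1 y.2 + h_act y.1 x.2).

Definition gform (x : lie_g) (y : lie_g1) : int :=
  formH x.1 y.1 +
  bilift (fun c e => (`[< iso (indrepr c : T) (shob (indrepr e)) >] : nat)%:Z) x.2 y.2.

(* [ht_ X] and [u_ X] are generators of [g]; [u1_ X] is [u_X] in [g_1]. *)
Definition ht_ (X : indObj T) : lie_g := (htilde X, 0).
Definition u_ (X : indObj T) : lie_g := (0, << indcls X >>).
Definition u1_ (X : indObj T) : lie_g1 := (0, << indcls X >>).

End LieAlgebra.

(* Main.v *)
Require Import Defs.
From HB Require Import structures.
From mathcomp Require Import all_boot all_order all_algebra all_fingroup zify ring.
From mathcomp Require Import finmap generic_quotient ring_quotient.
From mathcomp Require Import all_classical.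
From mathcomp Require Import freeg.

Set Implicit Arguments.
Unset Strict Implicit.
Unset Printing Implicit Defensive.

Import Order.TTheory GRing.Theory Num.Theory.
Local Open Scope ring_scope.

(** The first congruence is an equality of integers. By rotation of triangles and
    properness, the second reduces to [d(X) F_{XY}^L = d(Z) F_{YZ}^{L'}] mod
    [q - 1], where [L = TZ], [L' = TX], and neither [X] and [TY] nor [Y] and [TZ]
    are isomorphic. Let [G = Aut X * Aut Y * Aut L] act on the set [W] of exact triangles
    [Y -> L -> X -> TY]. Then [F_{XY}^L] is the number of orbits of
    [Aut X * Aut Y] on [W], and rotation identifies [F_{YZ}^{L'}] with the number
    of orbits of [Aut Y * Aut L]. As no map of such a triangle is zero and
    endomorphism rings are local, the stabilisers in these two subgroups are
    translates [1 + V] of [k]-subspaces, hence have order 1 mod [q - 1], while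
    [G] contains the scalars [k^*] acting trivially. Comparing the two numbers of
    orbits inside each [G]-orbit gives
    [|Aut X| / (q - 1) * F_{XY}^L = |Aut L| / (q - 1) * F_{YZ}^{L'}] mod [q - 1],
    and [|Aut X| = (q ^ d(X) - 1) |rad End X|] gives
    [|Aut X| / (q - 1) = d(X)] mod [q - 1]. *)


(** * Counting orbits of two normal subgroups *)

Section OrbitCount.
Local Open Scope group_scope.
Variables (gT : finGroupType) (wT : finType) (to : {action gT &-> wT}).
Implicit Types (G P Q K : {group gT}) (D : {set wT}).

(** As [P] equals its conjugate by [a], translation by [a] carries the [P]-orbit of [w] bijectively
    onto that of its translate. *)
Lemma card_orbit_normal G P w a : P <| G -> a \in G ->
  #|orbit to P (to w a)| = #|orbit to P w|.
Proof.
move=> /andP[_ nPG] Ga; rewrite -[in RHS](card_setact to _ a).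
congr #|pred_of_set _|; rewrite /setact.
have {1}-> : P = (P :^ a)%G by apply/val_inj; rewrite /= (normsP nPG).
apply/setP=> y; rewrite -{1}(actKV to a y) orbit_conjsg.
apply/idP/imsetP=> [yP|[z zP ->]]; last by rewrite actK.
by exists (to y a^-1) => //; rewrite actKV.
Qed.

(** An orbit of size m contributes m terms 1/m, hence exactly 1. *)
Lemma sum_inv_card_orbit P D : [acts P, on D | to] ->
  (\sum_(w in D) (#|orbit to P w|%:R)^-1 = #|[set orbit to P w | w in D]|%:R :> rat)%R.
Proof.
move=> actP; rewrite (set_partition_big _ (orbit_partition actP)) /=.
rewrite -sum1_card natr_sum; apply: eq_bigr => _ /imsetP[w _ ->].
rewrite (eq_bigr (fun _ => (#|orbit to P w|%:R)^-1%R)).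
  rewrite sumr_const -[LHS]mulr_natr mulVf // pnatr_eq0 -lt0n.
  by apply/card_gt0P; exists w; apply: orbit_refl.
by move=> x /orbit_eqP->.
Qed.

(** Let S be the stabiliser of [w] in [G]. All three equations are Lagrange counts in the chain P,
    PK, PS, G, with j = |PS : PK| and n = |G : PS|, the number of [P]-orbits inside the [G]-orbit of
    [w]. *)
Lemma card_orbit_ratio G P K w : P <| G -> K \subset G -> P :&: K = 1 ->
    K \subset 'C[w | to] ->
  exists n j, [/\ #|orbit to G w| = #|orbit to P w| * n, #|G : P| = #|K| * (n * j)
    & #|'C_G[w | to]| = #|'C_P[w | to]| * #|K| * j]%N.
Proof.
move=> nPG sKG PK1 sKS; set S := 'C_G[w | to]%G.
have [sPG nPG'] := andP nPG.
have sSG : S \subset G by apply: finset.subsetIl.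
have sKS' : K \subset S by rewrite finset.subsetI sKG.
have cPK : #|P * K| = (#|P| * #|K|)%N by rewrite TI_cardMg.
have PKg : P * K = P <*> K by rewrite norm_joinEr // (fintype.subset_trans sKG).
have PSg : P * S = P <*> S by rewrite norm_joinEr // (fintype.subset_trans sSG).
have dv : (#|P| * #|K| %| #|(P * S)%g|)%N.
  by rewrite -cPK PKg PSg cardSg // genS ?finset.setUS.
have [j Ej] := dvdnP dv.
have cPS : (#|(P * S)%g| * #|'C_P[w | to]|)%N = (#|P| * #|S|)%N.
  by rewrite mul_cardG /S /= finset.setIA (finset.setIidPl sPG).
have Es : #|S| = (#|'C_P[w | to]| * #|K| * j)%N.
  apply/eqP; rewrite -(eqn_pmul2l (cardG_gt0 P)) -cPS Ej; apply/eqP; ring.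
have := cardG_gt0 S; rewrite Es !muln_gt0 => /andP[/andP[c0 K0] j0].
have LPS : (#|(P * S)%g| * #|G : P <*> S|)%N = #|G|.
  by rewrite PSg Lagrange ?join_subG ?sPG.
exists #|G : P <*> S|, j; split=> //; apply/eqP.
  rewrite -(eqn_pmul2r (cardG_gt0 S)) card_orbit_stab -LPS Ej Es.
  rewrite -(card_orbit_stab to P w); apply/eqP; ring.
rewrite -(eqn_pmul2l (cardG_gt0 P)) Lagrange // -LPS Ej; apply/eqP; ring.
Qed.

(* Both counts are averages of [1 / |orbit|] over [D]; on a single [G]-orbit the
   difference of the two averages is a multiple of [|K|]. *)
Theorem orbit_count_congr G P Q K D aP aQ :
    P <| G -> Q <| G -> K \subset G -> P :&: K = 1 -> Q :&: K = 1 ->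
    [acts G, on D | to] ->
    {in D, forall w, K \subset 'C[w | to]} ->
    {in D, forall w, #|'C_P[w | to]| = 1 %[mod #|K|]}%N ->
    {in D, forall w, #|'C_Q[w | to]| = 1 %[mod #|K|]}%N ->
    #|G : P| = (#|K| * aP)%N -> #|G : Q| = (#|K| * aQ)%N ->
  (aQ * #|[set orbit to P w | w in D]| = aP * #|[set orbit to Q w | w in D]|
    %[mod #|K|])%N.
Proof.
move=> nP nQ sK PK QK actG KC cP cQ iP iQ.
have actP : [acts P, on D | to] by apply: fintype.subset_trans actG; case/andP: nP.
have actQ : [acts Q, on D | to] by apply: fintype.subset_trans actG; case/andP: nQ.
pose E w : rat := (aQ%:R / #|orbit to P w|%:R - aP%:R / #|orbit to Q w|%:R)%R.
have o0 (R : {group gT}) w : (#|orbit to R w|%:R != 0 :> rat)%R.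
  by rewrite pnatr_eq0 -lt0n; apply/card_gt0P; exists w; apply: orbit_refl.
have sumE O : O \in [set orbit to G w | w in D] ->
    exists z : int, (\sum_(w in O) E w = (#|K|%:Z * z)%:~R)%R.
  case/imsetP=> w wD ->.
  have EE x : x \in orbit to G w -> E x = E w.
    by case/imsetP=> a aG ->; rewrite /E !(card_orbit_normal _ _ aG).
  rewrite (eq_bigr _ EE) sumr_const -mulr_natl.
  have [n [i [tn iPn Si]]] := card_orbit_ratio nP sK PK (KC _ wD).
  have [m [j [tm iQm Sj]]] := card_orbit_ratio nQ sK QK (KC _ wD).
  move: (o0 P w) (o0 Q w) (cP _ wD) (cQ _ wD) => P0 Q0 cPw cQw.
  have K0 := cardG_gt0 K.
  have EP : aP = (n * i)%N by apply/eqP; rewrite -(eqn_pmul2l K0) -iP iPn.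
  have EQ : aQ = (m * j)%N by apply/eqP; rewrite -(eqn_pmul2l K0) -iQ iQm.
  (* Multiplied by |K|, both |C_P| i and |C_Q| j give the order of the stabiliser in [G], and |C_P|
     and |C_Q| are 1 modulo |K|. *)
  have ij : (i = j %[mod #|K|])%N.
    have /eqP : (#|'C_P[w | to]| * i = #|'C_Q[w | to]| * j)%N.
      apply/eqP; rewrite -(eqn_pmul2r K0) mulnAC -Si Sj; apply/eqP; ring.
    by move/eqP=> Eij; rewrite -[i]mul1n -modnMml -cPw modnMml Eij -modnMml cQw modnMml mul1n.
  have /dvdzP[z Ez] : (#|K|%:Z %| (j%:Z - i%:Z)%R)%Z.
    by rewrite -eqz_mod_dvd !modz_nat ij.
  (* The sum over the orbit is aQ n - aP m = (m j) n - (n i) m = n m (j - i). *)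
  exists (z * n%:Z * m%:Z)%R.
  rewrite /E mulrBr {1}tn tm !natrM.
  have -> : (#|K|%:Z * (z * n%:Z * m%:Z) = (j%:Z - i%:Z) * n%:Z * m%:Z)%R.
    by rewrite Ez; ring.
  rewrite EP EQ !intrM intrB !natrM.
  by field; rewrite P0 Q0.
have : exists z : int, (\sum_(w in D) E w = (#|K|%:Z * z)%:~R)%R.
  rewrite (set_partition_big _ (orbit_partition actG)) /=.
  elim/big_ind: _ => [|x y [u ->] [v ->]|O /sumE//]; first by exists 0%R; rewrite mulr0.
  by exists (u + v)%R; rewrite mulrDr intrD.
case=> z; rewrite sumrB -!mulr_sumr !sum_inv_card_orbit // -!natrM => Ez.
apply/eqP; rewrite -eqz_nat -!modz_nat eqz_mod_dvd; apply/dvdzP; exists z.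
by apply: (@intr_inj rat); rewrite mulrC -Ez intrB.
Qed.
End OrbitCount.

(** * Finite vector spaces *)

(* The proof [fA] is only there to carry the [finType] instance on [A]. *)
Definition finOf (A : choiceType) (fA : finite_set [set: A]) : Type := A.

Section FinOf.
Variables (A : choiceType) (fA : finite_set [set: A]).
HB.instance Definition _ := Choice.on (finOf fA).
Let S : {fset A} := fset_set [set: A].
Lemma finOf_mem (x : A) : x \in S.
Proof. by rewrite in_fset_set // in_setT. Qed.
Lemma finOfK : cancel (fun x : finOf fA => FSetSub (finOf_mem x)) (fun u : S => \val u : finOf fA).
Proof. by []. Qed.
HB.instance Definition _ := PCanIsCountable (can_pcan finOfK).
Lemma finOf_enumP : Finite.axiom (S : seq (finOf fA)).
Proof.
move=> x; have u : uniq (S : seq (finOf fA)) by exact: fset_uniq.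
have m : x \in (S : seq (finOf fA)) by exact: finOf_mem.
by rewrite (count_uniq_mem _ u) m.
Qed.
HB.instance Definition _ := isFinite.Build (finOf fA) finOf_enumP.
End FinOf.

Lemma expn_mod_pred q n : (0 < q)%N -> (q ^ n = 1 %[mod q.-1])%N.
Proof.
move=> q0; have Eq : (q %% q.-1 = 1 %% q.-1)%N by rewrite -{1}(prednK q0) -addn1 modnDl.
by rewrite -modnXm Eq modnXm exp1n.
Qed.

Section FiniteDimension.
Variables (k : finFieldType) (V : lmodType k) (fV : finite_set [set: V]).
Notation F := (finOf fV).

Definition subspace (W : set V) : Prop :=
  W 0 /\ forall a u v, W u -> W v -> W (a *: u + v).

(** The elements of [V] themselves form a finite generating family, giving a linear surjection [psi]
    from k^N to [V]. The preimage of [W] is a row space, so matrix cokernels provide coordinates on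
    V/W without choosing a basis of [V]. *)
Lemma finite_quotient_coord (W : set V) : subspace W ->
  exists n (f : {linear V -> 'rV[k]_n}),
    (forall y, exists x, f x = y) /\ (forall x, f x = 0 <-> W x).
Proof.
move=> [W0 WL]; pose N := #|{: F}|.
pose e (i : 'I_N) : V := (enum_val i : F).
pose psi (c : 'rV[k]_N) : V := \sum_i c 0 i *: e i.
have psiL a u v : psi (a *: u + v) = a *: psi u + psi v.
  rewrite /psi scaler_sumr -big_split; apply: eq_bigr => i _ /=.
  by rewrite !mxE scalerDl scalerA.
(* A section of [psi] that is not linear; [eqB] below makes the composite with [B] linear all the
   same. *)
pose sg (x : V) : 'rV[k]_N := delta_mx 0 (enum_rank (x : F)).
have sgK x : psi (sg x) = x.
  rewrite /psi (bigD1 (enum_rank (x : F))) //= big1 => [|i ne].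
    by rewrite addr0 mxE !eqxx scale1r /e enum_rankK.
  by rewrite mxE (negPf ne) andbF scale0r.
(* The rows list every vector that [psi] sends into [W], with 0 in place of the others, so the row
   space is the whole preimage of [W]. *)
pose A : 'M[k]_(#|{: 'rV[k]_N}|, N) :=
  \matrix_i (if `[< W (psi (enum_val i)) >] then enum_val i else 0).
have inA u : (u <= A)%MS <-> W (psi u).
  split=> [/submxP[D ->]|Wu].
    rewrite mulmx_sum_row; elim/big_rec: _ => [|i x _ Wx].
      suff -> : psi 0 = 0 by [].
      by rewrite /psi big1 // => i _; rewrite mxE scale0r.
    rewrite psiL; apply: WL => //; rewrite rowK; case: ifP => [/asboolP //|_].
    suff -> : psi 0 = 0 by [].
    by rewrite /psi big1 // => j _; rewrite mxE scale0r.
  have -> : u = row (enum_rank u) A by rewrite rowK enum_rankK asboolT.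
  exact: row_sub.
(* Multiplication by the cokernel matrix has the right kernel but need not be onto; its factor [B]
   has the same kernel and is onto. *)
pose B := col_base (cokermx A).
have cE : B *m row_base (cokermx A) = cokermx A by apply: mulmx_base.
have kerB u : u *m B = 0 <-> W (psi u).
  have cu : u *m cokermx A = u *m B *m row_base (cokermx A) by rewrite -mulmxA cE.
  rewrite -inA submxE cu mulmx_free_eq0 ?row_base_free //.
  by split=> [->|/eqP].
have eqB u v : psi u = psi v -> u *m B = v *m B.
  move=> E; apply/eqP; rewrite -subr_eq0 -mulmxBl; apply/eqP/kerB.
  by rewrite -scaleN1r addrC psiL E scaleN1r addNr.
pose f x := sg x *m B.
have fL : linear f.
  by move=> a x y; rewrite /f scalemxAl -mulmxDl; apply: eqB; rewrite psiL !sgK.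
pose fl := HB.pack_for {linear V -> 'rV[k]_(\rank (cokermx A))} f
  (GRing.isLinear.Build k V _ _ f fL).
exists (\rank (cokermx A)), fl; split=> [y|x]; last first.
  by rewrite -[in X in _ <-> X](sgK x) -kerB.
have /submxP[u ->] : (y <= B)%MS by rewrite submx_full // col_base_full.
by exists (psi u); apply: eqB; rewrite sgK.
Qed.

(** The coordinate map on V/W is onto and its fibres are the translates of [W]. Its existence also
    excludes the default value in [quotdim]. *)
Lemma card_quotdim (W : set V) : subspace W ->
  #|{: F}| = (#|k| ^ quotdim W * #|[set x : F | `[< W x >]]|)%N.
Proof.
move=> sW; have [n Wn] := finite_quotient_coord sW.
have [f [fs fk]] : exists f : {linear V -> 'rV[k]_(quotdim W)},
    (forall y, exists x, f x = y) /\ (forall x, f x = 0 <-> W x).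
  exact: (xgetPex 0%N (ex_intro (fun n => exists f : {linear V -> 'rV[k]_n}, _) n Wn)).
rewrite -[LHS]sum1_card (partition_big (f : F -> _) xpredT) //=.
rewrite (eq_bigr (fun=> #|[set x : F | `[< W x >]]|)) => [|y _].
  by rewrite sum_nat_const card_mx mul1n.
have [x0 fx0] := fs y.
transitivity #|[set x : F | f x == y]|; first by rewrite -sum1dep_card.
have inj : injective ((fun z : V => x0 + z) : F -> F) by apply: addrI.
rewrite -[RHS](card_imset _ inj).
apply: eq_card => x; rewrite [LHS]inE.
apply/eqP/imsetP => [fx|[z]].
  exists (x - x0 : V); last by rewrite addrC subrK.
  by rewrite inE; apply/asboolP/fk; rewrite linearB /= fx fx0 subrr.
by rewrite inE => /asboolP/fk fz ->; rewrite linearD /= fz fx0 addr0.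
Qed.

(** Counting [V] once through [W] and once through the zero subspace gives q^a |W| = q^b, and powers
    of q are 1 modulo q - 1. *)
Lemma card_subspace_mod (W : set V) : subspace W ->
  (#|[set x : F | `[< W x >]]| = 1 %[mod #|k|.-1])%N.
Proof.
move=> sW; have s0 : subspace [set (0 : V)].
  by split=> // a u v -> ->; rewrite scaler0 addr0.
have := card_quotdim sW; rewrite (card_quotdim s0).
have -> : #|[set x : F | `[< x = 0 :> V >]]| = 1%N.
  rewrite -(@cards1 F (0 : V)); apply: eq_card => x; rewrite [LHS]inE [RHS]inE.
  by apply/asboolP/eqP.
rewrite muln1 => E.
have q1 n := expn_mod_pred n (ltnW (card_finNzRing_gt1 k)).
by rewrite -[in LHS](mul1n #|_|) -modnMml -(q1 (quotdim W)) modnMml -E q1.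
Qed.
End FiniteDimension.

(** * Finite local endomorphism rings *)

Section Composition.
Variables (k : fieldType) (C : linCat k).
Implicit Types X Y Z : C.

Lemma compDl X Y Z (g g' : homk C Y Z) (f : homk C X Y) :
  (g + g') \oc f = g \oc f + g' \oc f.
Proof. by have := comp_linl f 1 g g'; rewrite !scale1r. Qed.

Lemma compDr X Y Z (g : homk C Y Z) (f f' : homk C X Y) :
  g \oc (f + f') = g \oc f + g \oc f'.
Proof. by have := comp_linr g 1 f f'; rewrite !scale1r. Qed.

Lemma comp0l X Y Z (f : homk C X Y) : (0 : homk C Y Z) \oc f = 0.
Proof. by apply: (@addrI _ (0 \oc f)); rewrite -compDl !addr0. Qed.

Lemma comp0r X Y Z (g : homk C Y Z) : g \oc (0 : homk C X Y) = 0.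
Proof. by apply: (@addrI _ (g \oc 0)); rewrite -compDr !addr0. Qed.

Lemma compNl X Y Z (g : homk C Y Z) (f : homk C X Y) : (- g) \oc f = - (g \oc f).
Proof. by apply/eqP; rewrite -addr_eq0 -compDl addNr comp0l. Qed.

Lemma compNr X Y Z (g : homk C Y Z) (f : homk C X Y) : g \oc (- f) = - (g \oc f).
Proof. by apply/eqP; rewrite -addr_eq0 -compDr addNr comp0r. Qed.

Lemma compBl X Y Z (g g' : homk C Y Z) (f : homk C X Y) :
  (g - g') \oc f = g \oc f - g' \oc f.
Proof. by rewrite compDl compNl. Qed.

Lemma compBr X Y Z (g : homk C Y Z) (f f' : homk C X Y) :
  g \oc (f - f') = g \oc f - g \oc f'.
Proof. by rewrite compDr compNr. Qed.

Lemma compZl X Y Z a (g : homk C Y Z) (f : homk C X Y) :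
  (a *: g) \oc f = a *: (g \oc f).
Proof. by have := comp_linl f a g 0; rewrite !addr0 comp0l addr0. Qed.

Lemma compZr X Y Z a (g : homk C Y Z) (f : homk C X Y) :
  g \oc (a *: f) = a *: (g \oc f).
Proof. by have := comp_linr g a f 0; rewrite !addr0 comp0r addr0. Qed.

Lemma id_isom X : is_isom (idhom X).
Proof. by exists (idhom X); split; rewrite comp1m. Qed.

Lemma isom_comp X Y Z (g : homk C Y Z) (f : homk C X Y) :
  is_isom g -> is_isom f -> is_isom (g \oc f).
Proof.
move=> [g' [g'g gg']] [f' [f'f ff']]; exists (f' \oc g'); split.
  by rewrite -compmA (compmA g' g f) g'g comp1m.
by rewrite -compmA (compmA f f' g') ff' comp1m.
Qed.

Lemma isom_inverse X Y (f : homk C X Y) g : inverse_of f g -> is_isom g.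
Proof. by case=> gf fg; exists f. Qed.

Lemma isom_opp X Y (f : homk C X Y) : is_isom f -> is_isom (- f).
Proof.
by case=> g [gf fg]; exists (- g); split; rewrite compNl compNr opprK.
Qed.

Lemma isom_cancelr X Y Z (g : homk C Y Z) (f : homk C X Y) :
  is_isom f -> g \oc f = 0 -> g = 0.
Proof. by case=> h [_ fh] E; rewrite -(compm1 g) -fh compmA E comp0l. Qed.

Lemma isom_cancell X Y Z (g : homk C Y Z) (f : homk C X Y) :
  is_isom g -> g \oc f = 0 -> f = 0.
Proof. by case=> h [hg _] E; rewrite -(comp1m f) -hg -compmA E comp0r. Qed.

Lemma isom_factorr X Y (v : homk C Y X) (a : homk C X Y) :
  is_isom v -> is_isom (v \oc a) -> is_isom a.
Proof.
move=> [u [uv vu]] va; have -> : a = u \oc (v \oc a) by rewrite compmA uv comp1m.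
by apply: isom_comp => //; exists v.
Qed.

Lemma is_zeroP X : is_zero X <-> idhom X = 0.
Proof.
split=> [/(_ X)[H _]|id0 Y]; [exact: H | split=> f].
  by rewrite -(compm1 f) id0 comp0r.
by rewrite -(comp1m f) id0 comp0l.
Qed.

(** An alias for the Hom-space, on which composition becomes a ring multiplication. *)
Definition endo X : Type := homk C X X.
HB.instance Definition _ X := GRing.Zmodule.copy (endo X) (homk C X X : zmodType).
HB.instance Definition _ X := GRing.Zmodule_isPzRing.Build (endo X)
  (fun h g f => compmA h g f) (fun f => comp1m f) (fun f => compm1 f)
  (fun g g' f => compDl g g' f) (fun g f f' => compDr g f f').
End Composition.

Lemma finite_ring_idem (R : pzRingType) (x : R) : finite_set [set: R] ->
  exists2 n, (0 < n)%N & x ^+ n * x ^+ n = x ^+ n.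
Proof.
move=> fR; pose f (i : 'I_(#|{: finOf fR}|.+1)) : finOf fR := x ^+ i.
have [i0 [j0 ij0 e0]] : exists i0, exists2 j0, i0 != j0 & f i0 = f j0.
  by apply/injectivePn/negP => /injectiveP/leq_card; rewrite card_ord ltnn.
have [i [j [ij e]]] : exists i j : nat, (i < j)%N /\ x ^+ i = x ^+ j.
  case: (ltngtP i0 j0) => [l|l|/val_inj E]; first by exists i0, j0.
  - by exists j0, i0.
  - by rewrite E eqxx in ij0.
have shift m l : (i <= m)%N -> x ^+ (m + l * (j - i)) = x ^+ m.
  move=> im; elim: l => [|l <-]; first by rewrite mul0n addn0.
  have -> : (m + l.+1 * (j - i) = j + (m - i + l * (j - i)))%N.
    by rewrite mulSn -{1}(subnKC im) -{3}(subnKC (ltnW ij)); lia.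
  by rewrite exprD -e -exprD addnA subnKC.
(* From exponent [i] on, the powers of [x] have period j - i. The chosen exponent is a positive
   multiple of this period and at least [i], so doubling it changes nothing. *)
exists (i.+1 * (j - i))%N; first by rewrite muln_gt0 subn_gt0.
by rewrite -exprD shift // (leq_trans (leqnSn i)) // leq_pmulr // subn_gt0.
Qed.

Section LocalEndomorphisms.
Variables (k : finFieldType) (C : linCat k) (idemC : idempotent_complete C).
Implicit Types X Y Z : C.

(** By idempotent completeness [e] and 1 - [e] both split, and their images form a biproduct
    decomposition of [X]; conversely a decomposition yields the idempotent [i1 \oc p1]. *)
Lemma indecomposableP X : indecomposable X <->
  idhom X <> 0 /\ forall e : homk C X X, e \oc e = e -> e = 0 \/ e = idhom X.
Proof.
split=> [[nz dec]|[nz dec]]; split; [by move/is_zeroP| |by move/is_zeroP|].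
  move=> e ee.
  have [Y [p [i [pi ip]]]] := idemC ee.
  have e1 : (idhom X - e) \oc (idhom X - e) = idhom X - e.
    by rewrite compBl !compBr !compm1 comp1m ee subrr subr0.
  have [Y' [p' [i' [pi' ip']]]] := idemC e1.
  have pe : p \oc e = p by rewrite -ip compmA pi comp1m.
  have ei : e \oc i = i by rewrite -ip -compmA pi compm1.
  have ei' : (idhom X - e) \oc i' = i' by rewrite -ip' -compmA pi' compm1.
  have pe' : p' \oc (idhom X - e) = p' by rewrite -ip' compmA pi' comp1m.
  have [|/is_zeroP Y0|/is_zeroP Y0] := dec Y Y'.
  - exists i, i', p, p'; split=> //; last by rewrite ip ip' addrC subrK.
      by rewrite -ei' compmA compBr compm1 pe subrr comp0l.
    by rewrite -pe' -compmA compBl comp1m ei subrr comp0r.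
  - by left; rewrite -ip -(comp1m p) Y0 comp0l comp0r.
  - by right; apply/eqP; rewrite eq_sym -subr_eq0 -ip' -(comp1m p') Y0 comp0l comp0r.
move=> A B [i1 [i2 [p1 [p2 [pi1 pi2 pi12 pi21 s]]]]].
case: (dec (i1 \oc p1)) => [|E|E].
- by rewrite -compmA (compmA p1 i1 p1) pi1 comp1m.
- left; apply/is_zeroP.
  by rewrite -pi1 -(comp1m p1) -{1}pi1 -(compmA p1 i1 p1) E comp0r comp0l.
- right; apply/is_zeroP.
  rewrite -pi2 -(comp1m p2) -pi2 -(compmA p2 i2 p2).
  have -> : i2 \oc p2 = 0 by apply: (@addrI _ (i1 \oc p1)); rewrite s E addr0.
  by rewrite comp0r comp0l.
Qed.

Variables (X : C) (indX : indecomposable X) (finX : finite_set [set: homk C X X]).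

Lemma indec_id_neq0 : idhom X <> 0. Proof. by have /indecomposableP[] := indX. Qed.

(** A Fitting-type argument: some positive power of [f] is idempotent, hence 0 or the identity. *)
Lemma isom_or_nilpotent (f : endo X) : is_isom f \/ exists n, f ^+ n = 0.
Proof.
have [n n0 fn] := finite_ring_idem f finX.
have /indecomposableP[_ dec] := indX.
case: (dec (f ^+ n) fn) => [E|E]; [by right; exists n | left].
by exists (f ^+ n.-1); split; [rewrite -[LHS]exprSr|rewrite -[LHS]exprS]; rewrite prednK.
Qed.

(** If [f] were nilpotent, g^n f^n = 1 would force the identity to vanish. *)
Lemma linv_isom (f g : endo X) : g * f = 1 -> is_isom f.
Proof.
move=> gf; case: (isom_or_nilpotent f) => // -[n].
suff E : g ^+ n * f ^+ n = 1.
  by move=> fn; case: indec_id_neq0; rewrite -[LHS]E fn mulr0.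
elim: n => [|n IHn]; first by rewrite !expr0 mulr1.
by rewrite exprSr exprS mulrA -(mulrA _ g) gf mulr1.
Qed.

(** Such an [f] is nilpotent, and the finite geometric series is a left inverse of 1 - [f]. *)
Lemma nonisom_sub1 (f : endo X) : ~ is_isom f -> is_isom (1 - f).
Proof.
move=> nf; case: (isom_or_nilpotent f) => // -[n fn].
apply: (@linv_isom _ (\sum_(i < n) f ^+ i)).
have cf : f * (\sum_(i < n) f ^+ i) = (\sum_(i < n) f ^+ i) * f.
  by rewrite mulr_sumr mulr_suml; apply: eq_bigr => i _; rewrite -exprS -exprSr.
rewrite mulrBr mulr1 -cf -{1}(mul1r (\sum_(i < n) _)) -mulrBl -opprB mulNr.
by rewrite -subrX1 fn sub0r opprK.
Qed.

Lemma nonisom_add1 (f : endo X) : ~ is_isom f -> is_isom (1 + f).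
Proof.
move=> nf; rewrite -[f]opprK; apply: nonisom_sub1 => /isom_opp.
by rewrite opprK.
Qed.

(** This is locality of End X. For differences: if v (a - b) = 1 with [a] a non-isomorphism, then v
    b = v a - 1 is invertible, and so is [b]. *)
Lemma nonisom_left_ideal : left_ideal [set f : homk C X X | ~ is_isom f]%classic.
Proof.
split=> [[g [_ g0]]|a b na nb|a b nb] /=.
- by apply: indec_id_neq0; rewrite -g0 comp0l.
- move=> iu; have [v uv] := iu.
  have iv : is_isom v by apply: isom_inverse uv.
  apply: nb.
  have {uv} : v \oc a - v \oc b = idhom X by rewrite -compBr; case: uv.
  move=> /eqP; rewrite subr_eq addrC -subr_eq => /eqP Eb.
  apply: (isom_factorr iv); rewrite -Eb -opprB; apply: isom_opp.
  by apply: nonisom_sub1 => /(isom_factorr iv).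
- move=> [g [gab _]]; apply: nb.
  by apply: (@linv_isom _ (g \oc a)); rewrite -[LHS]compmA.
Qed.

(** A proper left ideal contains no isomorphism, so the ideal of non-isomorphisms is the only
    maximal one. *)
Lemma rad_endE : @rad_end k C X = [set f | ~ is_isom f]%classic.
Proof.
have no_isom I : left_ideal I -> ~ I (idhom X) -> (I `<=` [set f | ~ is_isom f])%classic.
  by move=> [_ _ Il] I1 f If [g [gf _]]; apply: I1; rewrite -gf; apply: Il.
have N1 : ~ [set f : homk C X X | ~ is_isom f]%classic (idhom X) by apply; apply: id_isom.
apply/seteqP; split=> f.
  apply; split=> // [|J iJ sJ J1]; first exact: nonisom_left_ideal.
  by apply/seteqP; split=> //; apply: no_isom.
move=> nf I [iI I1 Imax]; rewrite -(Imax _ nonisom_left_ideal) //.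
exact: no_isom.
Qed.

Lemma rad_end_subspace : subspace (@rad_end k C X).
Proof.
rewrite rad_endE; have [N0 NB Nl] := nonisom_left_ideal.
have NZ a (u : homk C X X) : ~ is_isom u -> ~ is_isom (a *: u).
  by move=> nu; have := Nl (a *: idhom X) u nu; rewrite compZl comp1m.
split=> // a u v nu nv; rewrite -[v]opprK; apply: NB; first exact: NZ.
by rewrite -scaleN1r; apply: NZ.
Qed.

Lemma card_endo :
  #|{: finOf finX}| =
    (#|k| ^ dEnd X * #|[set x : finOf finX | ~~ `[< is_isom (x : endo X) >]]|)%N.
Proof.
rewrite (card_quotdim finX rad_end_subspace); congr (_ * _)%N.
by apply: eq_card => x; rewrite [LHS]inE [RHS]inE rad_endE -asbool_neg.
Qed.

Lemma nonisom_mod :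
  (#|[set x : finOf finX | ~~ `[< is_isom (x : endo X) >]]| = 1 %[mod #|k|.-1])%N.
Proof.
rewrite -(card_subspace_mod finX rad_end_subspace) rad_endE.
by congr (_ %% _)%N; apply: eq_card => x; rewrite [LHS]inE [RHS]inE -asbool_neg.
Qed.

Lemma card_autom : exists2 a,
  #|[set x : finOf finX | `[< is_isom (x : endo X) >]]| = (#|k|.-1 * a)%N
  & a = dEnd X %[mod #|k|.-1].
Proof.
have := card_endo; have := nonisom_mod.
rewrite -(cardsC [set x : finOf finX | `[< is_isom (x : endo X) >]]).
have -> : ~: [set x : finOf finX | `[< is_isom (x : endo X) >]] =
   [set x : finOf finX | ~~ `[< is_isom (x : endo X) >]].
  by apply/setP=> x; rewrite !inE.
move: #|[set x : finOf finX | _]| #|[set x : finOf finX | ~~ _]| => u m m1 E.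
(* With m = |rad End X|, the order of Aut X is (q^d - 1) m, and q^d - 1 is q - 1 times a geometric
   sum of d terms. Each term is 1 modulo q - 1, and so is m. *)
exists ((\sum_(i < dEnd X) #|k| ^ i) * m)%N; last first.
  rewrite -modnMmr m1 modnMmr muln1 -modn_summ.
  rewrite (eq_bigr (fun=> 1 %% #|k|.-1)%N) => [|i _]; last first.
    exact/expn_mod_pred/ltnW/card_finNzRing_gt1.
  by rewrite modn_summ sum_nat_const card_ord muln1.
by rewrite mulnA -predn_exp -subn1 mulnBl -E mul1n addnK.
Qed.

(** Otherwise, by cardinality, every endomorphism would be a non-isomorphism, the identity
    included. *)
Lemma dEnd_gt0 : (0 < dEnd X)%N.
Proof.
rewrite lt0n; apply/eqP => d0; have := card_endo; rewrite d0 expn0 mul1n => E.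
have : (idhom X : finOf finX) \in [set x : finOf finX | ~~ `[< is_isom (x : endo X) >]].
  by have /eqP -> : [set x : finOf finX | ~~ `[< is_isom (x : endo X) >]] == [set: _];
    rewrite ?inE // eqEcard finset.subsetT finset.cardsT E leqnn.
by rewrite inE asboolT //; apply: id_isom.
Qed.
End LocalEndomorphisms.

Section LocalConsequences.
Variables (k : finFieldType) (C : linCat k) (idemC : idempotent_complete C).
Implicit Types X Y : C.

(** The idempotent [i \oc p] is 0 or the identity, and 0 would kill the identity of [Y]. *)
Lemma split_epi_isom X Y (p : homk C X Y) (i : homk C Y X) :
  indecomposable X -> idhom Y <> 0 -> p \oc i = idhom Y -> is_isom p.
Proof.
move=> /(indecomposableP idemC)[_ dec] nY pi.
case: (dec (i \oc p)) => [|E|E]; last by exists i; split.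
  by rewrite -compmA (compmA p i p) pi comp1m.
by case: nY; rewrite -pi -(comp1m p) -pi -(compmA p i p) E comp0r comp0l.
Qed.

(** By |End X| = q^d(X) |rad End X|, the number d(X) depends only on how many endomorphisms and how
    many non-isomorphisms there are, so a bijection of sets suffices. *)
Lemma dEnd_bij X Y (phi : homk C X X -> homk C Y Y) :
    indecomposable X -> indecomposable Y ->
    finite_set [set: homk C X X] -> finite_set [set: homk C Y Y] ->
    bijective phi -> (forall f, is_isom (phi f) <-> is_isom f) ->
  dEnd X = dEnd Y.
Proof.
move=> iX iY fX fY bphi isophi.
have bphi' : bijective (phi : finOf fX -> finOf fY) by [].
have inj := bij_inj bphi'.
have EN : #|[set x : finOf fX | ~~ `[< is_isom (x : endo X) >]]| =
          #|[set x : finOf fY | ~~ `[< is_isom (x : endo Y) >]]|.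
  rewrite -(card_imset _ inj); apply: eq_card => y; rewrite [RHS]inE.
  have [psi phiK psiK] := bphi'.
  rewrite -[y in RHS]psiK; apply/imsetP/idP => [[x xN ->]|nN].
    rewrite phiK; move: xN; rewrite inE; apply: contra => /asboolP/isophi ix.
    exact/asboolP.
  exists (psi y) => //; rewrite inE; apply: contra nN => /asboolP ix.
  exact/asboolP/isophi.
have := card_endo idemC iX fX; rewrite (bij_eq_card bphi') EN (card_endo idemC iY fY).
move/eqP; rewrite eqn_pmul2r; last first.
  rewrite card_gt0; apply/set0Pn; exists (0 : homk C Y Y); rewrite inE.
  by apply/asboolP => /isom_cancell-/(_ Y (idhom Y)); rewrite comp0l => /(_ erefl); apply: (indec_id_neq0 idemC iY).
by rewrite eqn_exp2l ?card_finNzRing_gt1 // => /eqP.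
Qed.
End LocalConsequences.

(** * Exact triangles *)

Section Triangles.
Variables (k : fieldType) (T : triCat k).
Implicit Types X Y Z U L : T.

Lemma shm_inj X Y : injective (shm : homk T X Y -> _).
Proof. exact: bij_inj (shm_bij X Y). Qed.

Lemma shm_full X Y (f : homk T (shob X) (shob Y)) : exists g, shm g = f.
Proof. by have [psi _ psiK] := shm_bij X Y; exists (psi f). Qed.

Lemma shm_isom X Y (f : homk T X Y) : is_isom (shm f) <-> is_isom f.
Proof.
split=> [[g']|[g [gf fg]]]; last first.
  by exists (shm g); split; rewrite -shm_comp ?gf ?fg shm_id.
have [g <-] := shm_full g'; rewrite /inverse_of -!shm_comp -!shm_id.
by case=> /shm_inj gf /shm_inj fg; exists g.
Qed.

Lemma iso_sh X Y : iso (shob X) (shob Y) <-> iso X Y.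
Proof.
split=> [[f']|[f /shm_isom]]; last by exists (shm f).
by have [f <-] := shm_full f' => /shm_isom; exists f.
Qed.

Lemma sh_zero X : is_zero X -> is_zero (shob X).
Proof. by move/is_zeroP => X0; apply/is_zeroP; rewrite -shm_id X0 linear0. Qed.

Section Exact.
Variables (X Y Z : T).
Variables (f : homk T X Y) (g : homk T Y Z) (h : homk T Z (shob X)).
Hypothesis tri : exact_tri f g h.

(** TR3, applied to the morphism with components 0 and [u] into the triangle O -> U = U -> TO,
    provides the factorisation. *)
Lemma exact_coker U (u : homk T Y U) : u \oc f = 0 -> exists c, c \oc g = u.
Proof.
move=> uf; have [O O0] := has_zero T.
have t0 : exact_tri (0 : homk T O U) (idhom U) (0 : homk T U (shob O)).
  apply/exact_rot; have := exact_id U (sh_zero O0).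
  by rewrite linear0 oppr0; congr exact_tri; case: (sh_zero O0 (shob U)) => H _; rewrite !H.
have [|c [E _]] := exact_mor tri t0 (a := 0) (b := u); first by rewrite uf comp0l.
by exists c; rewrite E comp1m.
Qed.

(** TR3 is applied to the rotations of U = U -> O -> TU and of the given triangle; it yields a map
    TU -> TX, which descends because the shift is fully faithful. *)
Lemma exact_ker U (u : homk T U Y) : g \oc u = 0 -> exists c, f \oc c = u.
Proof.
move=> gu; have [O O0] := has_zero T.
have /exact_rot t0 := exact_id U O0.
have /exact_rot t1 := tri.
have [|c [_]] := exact_mor t0 t1 (a := u) (b := 0); first by rewrite gu comp0l.
have [v <-] := shm_full c.
rewrite shm_id compNr compm1 compNl -shm_comp => /oppr_inj/shm_inj ->.
by exists v.
Qed.
End Exact.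
End Triangles.

Section TrianglesOfIndecomposables.
Variables (k : finFieldType) (T : triCat k) (idemT : idempotent_complete T).
Variable (finT : forall X Y : T, finite_set [set: homk T X Y]).
Implicit Types X Y Z U L : T.

Lemma sh_indec X : indecomposable X -> indecomposable (shob X).
Proof.
move=> /(indecomposableP idemT)[X0 dec]; apply/(indecomposableP idemT).
rewrite -shm_id; split=> [|e'].
  by rewrite -(linear0 (shm : {linear _ -> homk T (shob X) (shob X)})) => /shm_inj.
have [e <-] := shm_full e'; rewrite -shm_comp => /shm_inj/dec.
by case=> ->; [left; rewrite linear0|right].
Qed.

Lemma dEnd_sh X : indecomposable X -> dEnd (shob X) = dEnd X.
Proof.
move=> iX; symmetry; apply: (dEnd_bij idemT iX (sh_indec iX) (finT _ _) (finT _ _) (shm_bij X X)).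
exact: shm_isom.
Qed.

Lemma iso_indec X Y : iso X Y -> indecomposable X -> indecomposable Y.
Proof.
move=> [u [v [vu uv]]] /(indecomposableP idemT)[X0 dec].
apply/(indecomposableP idemT); split=> [Y0|e ee].
  by apply: X0; rewrite -vu -(comp1m u) Y0 comp0l comp0r.
have E : e = u \oc (v \oc e \oc u) \oc v.
  by rewrite !compmA uv comp1m -compmA uv compm1.
case: (dec (v \oc e \oc u)) => [|E0|E1].
- by rewrite -!compmA (compmA u v) uv comp1m (compmA e e) ee.
- by left; rewrite E E0 comp0r comp0l.
- by right; rewrite E E1 compm1 uv.
Qed.

Lemma dEnd_iso X Y : indecomposable X -> iso X Y -> dEnd X = dEnd Y.
Proof.
move=> iX XY; have iY := iso_indec XY iX; case: XY => u [v [vu uv]].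
have isou : is_isom u by exists v.
have isov : is_isom v by exists u.
apply: (dEnd_bij (phi := fun f => u \oc f \oc v) idemT iX iY (finT _ _) (finT _ _)).
  exists (fun f => v \oc f \oc u) => f.
    by rewrite !compmA vu comp1m -compmA vu compm1.
  by rewrite !compmA uv comp1m -compmA uv compm1.
move=> f; split=> [uf|fi]; last exact: isom_comp (isom_comp _ _) _.
have -> : f = v \oc (u \oc f \oc v) \oc u by rewrite !compmA vu comp1m -compmA vu compm1.
exact: isom_comp (isom_comp _ _) _.
Qed.

Section Nonzero.
Variables (X Y L : T) (iX : indecomposable X) (iY : indecomposable Y) (iL : indecomposable L).
Variables (f : homk T Y L) (g : homk T L X) (h : homk T X (shob Y)).
Hypothesis tri : exact_tri f g h.

(** If [f] or [g] vanishes, exactness gives [h] a one-sided inverse, and between indecomposables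
    this makes X and TY isomorphic. *)
Lemma tri_fg_neq0 : ~ iso X (shob Y) -> f <> 0 /\ g <> 0.
Proof.
move=> nXY; have t1 := (iffLR (exact_rot _ _ _) tri).
have t2 := (iffLR (exact_rot _ _ _) t1).
split=> E0; apply: nXY.
  have [|c hc] := exact_ker t2 (u := idhom (shob Y)).
    by rewrite compm1 E0 linear0 oppr0.
  by exists h; apply: (split_epi_isom idemT iX (indec_id_neq0 idemT (sh_indec iY)) hc).
have [|c ch] := exact_coker t1 (u := idhom X); first by rewrite comp1m.
apply: iso_sym; exists c.
exact: (split_epi_isom idemT (sh_indec iY) (indec_id_neq0 idemT iX) ch).
Qed.

(** If [g] vanishes then [f] has a right inverse; if [h] vanishes then the shift of [f] has a left
    inverse. Either way Y and L are isomorphic. *)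
Lemma tri_gh_neq0 : ~ iso Y L -> g <> 0 /\ h <> 0.
Proof.
move=> nYL; have t1 := (iffLR (exact_rot _ _ _) tri).
have t2 := (iffLR (exact_rot _ _ _) t1).
split=> E0; apply: nYL.
  have [|c fc] := exact_ker tri (u := idhom L); first by rewrite compm1.
  by exists f; apply: (split_epi_isom idemT iY (indec_id_neq0 idemT iL) fc).
have [|c cf] := exact_coker t2 (u := idhom (shob Y)); first by rewrite comp1m.
apply/iso_sh/iso_sym; exists c.
exact: (split_epi_isom idemT (sh_indec iL) (indec_id_neq0 idemT (sh_indec iY)) cf).
Qed.
End Nonzero.
End TrianglesOfIndecomposables.

(** * Orbits of triangles *)

(** Transports the count of orbits as classical sets, used in [Fnum], to orbits of a finite group
    action. It serves once with [psi] the identity and once with [psi] the rotation of triangles. *)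
Lemma card_orbit_sets (gT : finGroupType) (A : finType) (to : {action gT &-> A})
    (P : {group gT}) (D : {set A}) (U : choiceType) (tr : set U)
    (orb : U -> set U) (psi : U -> A) :
    (forall u, tr u <-> psi u \in D) -> (forall a, exists u, psi u = a) ->
    (forall u u', orb u u' <-> psi u' \in orbit to P (psi u)) ->
  #|` fset_set [set orb u | u in tr]%classic| = #|[set orbit to P a | a in D]|.
Proof.
move=> trD psi_surj orbP.
pose th (S : set U) : {set A} := [set a | `[< exists2 u, S u & psi u = a >]].
have thE u : th (orb u) = orbit to P (psi u).
  apply/setP=> a; rewrite inE; apply/asboolP/idP => [[u' /orbP ? <-] //|].
  by have [u' <-] := psi_surj a => /orbP; exists u'.
apply: card_fset_set.
have thI : {in [set orb u | u in tr]%classic &, injective th}.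
  move=> _ _ /set_mem[u _ <-] /set_mem[u' _ <-]; rewrite !thE => E.
  by apply/seteqP; split=> v /orbP; rewrite (E, esym E) => /orbP.
have := inj_card_eq thI; rewrite card_eq_sym => /card_eq_trans; apply.
pose E := [set orbit to P a | a in D].
have -> : (th @` [set orb u | u in tr])%classic = [set` [fset x in enum E]%fset]%classic.
  apply/seteqP; split=> S /=; rewrite !inE /= mem_enum.
    by move=> [_ [u /trD uD <-] <-]; rewrite thE; apply: imset_f.
  case/imsetP=> a aD ->; have [u ua] := psi_surj a.
  by exists (orb u); [exists u => //; apply/trD; rewrite ua|rewrite thE ua].
apply/card_eq_fsetP; rewrite card_fseq undup_id ?enum_uniq //.
by rewrite cardE.
Qed.

Lemma scale_isom (k : fieldType) (C : linCat k) (A : C) (u : k) :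
  u \is a GRing.unit -> is_isom (u *: idhom A).
Proof.
move=> uu; exists (u^-1 *: idhom A).
by split; rewrite compZl compZr comp1m scalerA ?mulVr ?divrr // scale1r.
Qed.

(** * The finite automorphism group of an object *)

Section AutomorphismGroup.
Variables (k : fieldType) (C : linCat k) (X : C).
Variable (fX : finite_set [set: homk C X X]).

Definition autT : Type := {f : finOf fX | `[< is_isom (f : homk C X X) >]}.
HB.instance Definition _ := Finite.on autT.

Definition aval (a : autT) : homk C X X := val a.
Definition mkaut f (fi : is_isom f) : autT := exist _ f (asboolT fi).

Lemma aval_inj : injective aval. Proof. exact: val_inj. Qed.
Lemma aval_isom (a : autT) : is_isom (aval a). Proof. exact: asboolW (valP a). Qed.
Lemma mkautK f (fi : is_isom f) : aval (mkaut fi) = f. Proof. by []. Qed.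

Definition aut_mul a b := mkaut (isom_comp (aval_isom a) (aval_isom b)).
Definition aut_one := mkaut (id_isom X).
Definition aut_inv a := mkaut (isom_inverse (projT2 (cid (aval_isom a)))).

Lemma aut_mulA : associative aut_mul.
Proof. by move=> a b c; apply: aval_inj; rewrite !mkautK compmA. Qed.
Lemma aut_mul1 : left_id aut_one aut_mul.
Proof. by move=> a; apply: aval_inj; rewrite !mkautK comp1m. Qed.
Lemma aut_mulV : left_inverse aut_one aut_inv aut_mul.
Proof.
by move=> a; apply: aval_inj; rewrite !mkautK; case: (projT2 (cid (aval_isom a))).
Qed.
HB.instance Definition _ := Finite_isGroup.Build autT aut_mulA aut_mul1 aut_mulV.

Lemma avalM (a b : autT) : aval (a * b)%g = aval a \oc aval b. Proof. by []. Qed.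
Lemma aval1 : aval 1%g = idhom X. Proof. by []. Qed.
Lemma avalVK (a : autT) : aval a^-1%g \oc aval a = idhom X.
Proof. by rewrite -avalM mulVg. Qed.
Lemma avalKV (a : autT) : aval a \oc aval a^-1%g = idhom X.
Proof. by rewrite -avalM mulgV. Qed.
Lemma avalV_inverse (a : autT) : inverse_of (aval a^-1%g) (aval a).
Proof. by split; [exact: avalKV|exact: avalVK]. Qed.
Lemma inverse_avalV f g : inverse_of f g ->
  exists a : autT, aval a = g /\ aval a^-1%g = f.
Proof.
move=> fg; have ig := isom_inverse fg; exists (mkaut ig); split=> //.
have /(congr1 (fun h => h \oc f)) := avalVK (mkaut ig).
by case: fg => gf _; rewrite -compmA mkautK gf comp1m compm1.
Qed.
End AutomorphismGroup.

(** * Automorphisms of X, Y and L acting on triangles *)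

Section TriangleAction.
Variables (k : finFieldType) (T : triCat k) (idemT : idempotent_complete T).
Variable (finT : forall X Y : T, finite_set [set: homk T X Y]).
Variables (X Y L : T).
Local Notation H A B := (finOf (finT A B)).
Definition triple : Type := (H Y L * H L X * H X (shob Y))%type.
HB.instance Definition _ := Finite.on triple.
Definition autG : Type := (autT (finT X X) * autT (finT Y Y) * autT (finT L L))%type.
HB.instance Definition _ := FinGroup.on autG.

(* The action defining [Fnum] taken through inverses, since MathComp actions are
   on the right. *)
Definition tri_act (w : triple) (a : autG) : triple :=
  (aval a.2^-1%g \oc w.1.1 \oc aval a.1.2,
   aval a.1.1^-1%g \oc w.1.2 \oc aval a.2,
   shm (aval a.1.2^-1%g) \oc w.2 \oc aval a.1.1).

Lemma tri_act1 : tri_act^~ 1%g =1 id.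
Proof.
move=> [[f g] h]; rewrite /tri_act /= !invg1 !aval1.
by rewrite !compm1 !comp1m shm_id comp1m.
Qed.

Lemma tri_actM w : act_morph tri_act w.
Proof.
move=> a b; rewrite /tri_act /= !invMg !avalM.
by rewrite !shm_comp !compmA.
Qed.

Canonical tri_action := TotalAction tri_act1 tri_actM.

Definition triset : {set triple} :=
  [set w : triple | `[< exact_tri (w.1.1 : homk T Y L) (w.1.2 : homk T L X) w.2 >]].

Lemma tri_acts : [acts [set: autG], on triset | tri_action].
Proof.
have H w (a : autG) : w \in triset -> tri_action w a \in triset.
  rewrite !inE => tw.
  refine (exact_iso (aval_isom a.1.2^-1%g) (aval_isom a.2^-1%g) (aval_isom a.1.1^-1%g) _ _ _ tw).
  - by rewrite -!compmA avalKV compm1.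
  - by rewrite -!compmA avalKV compm1.
  - by rewrite -!compmA avalKV compm1.
apply/actsP=> a _ w; apply/idP/idP => [/(H _ a^-1%g)|/H//].
by rewrite actK.
Qed.

Definition aut_scale (A : T) (u : {unit k}) : autT (finT A A) :=
  mkaut (finT A A) (scale_isom A (valP u)).

Lemma aut_scaleM A : {morph aut_scale A : u v / (u * v)%g}.
Proof. by move=> u v; apply: aval_inj; rewrite avalM !mkautK compZl compZr comp1m scalerA. Qed.

Lemma aut_scaleV A u : aval (aut_scale A u)^-1%g = (val u)^-1 *: idhom A.
Proof.
have /(congr1 (fun h => (val u)^-1 *: h)) := avalVK (aut_scale A u).
by rewrite mkautK compZr compm1 scalerA mulVr ?scale1r //; exact: valP.
Qed.

Definition tri_scale (u : {unit k}) : autG := (aut_scale X u, aut_scale Y u, aut_scale L u).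

Lemma tri_scaleM : {in [set: {unit k}] &, {morph tri_scale : u v / (u * v)%g}}.
Proof. by move=> u v _ _; rewrite /tri_scale !aut_scaleM. Qed.
Canonical tri_scale_morphism := Morphism tri_scaleM.

(** Each map of the triangle is multiplied by u and by its inverse, the shift being k-linear. *)
Lemma tri_scale_fix w u : tri_act w (tri_scale u) = w.
Proof.
have uu : (val u : k) / val u = 1 by rewrite divrr //; exact: valP.
case: w => [[f g] h]; rewrite /tri_act /= !aut_scaleV linearZ /=.
have uV : (val u)^-1 * val u = 1 by rewrite mulrC.
by rewrite shm_id !mkautK !compZl !compZr !comp1m !compm1 !scalerA ?uu ?uV !scale1r.
Qed.

Definition scalars : {group autG} := (tri_scale_morphism @* [set: {unit k}])%G.

(** Aut X * Aut Y is taken as the kernel of the projection to Aut L, and [autYL] as the kernel of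
    the projection to Aut X; this makes both normal. *)
Definition autXY : {set autG} := [set a | a.2 == 1%g].
Definition autYL : {set autG} := [set a | a.1.1 == 1%g].

Lemma autXY_group : group_set autXY.
Proof.
apply/group_setP; split=> [|a b]; first by rewrite inE.
by rewrite !inE => /eqP a1 /eqP b1; rewrite /= a1 b1 mulg1.
Qed.
Canonical autXY_Group := Group autXY_group.

Lemma autYL_group : group_set autYL.
Proof.
apply/group_setP; split=> [|a b]; first by rewrite inE.
by rewrite !inE => /eqP a1 /eqP b1; rewrite /= a1 b1 mulg1.
Qed.
Canonical autYL_Group := Group autYL_group.

Lemma autXY_normal : (autXY <| [set: autG])%g.
Proof.
rewrite /normal finset.subsetT; apply/fintype.subsetP=> a _; rewrite inE.
by apply/fintype.subsetP=> _ /imsetP[b + ->]; rewrite !inE => /eqP b1; rewrite /= b1 mul1g mulVg.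
Qed.

Lemma autYL_normal : (autYL <| [set: autG])%g.
Proof.
rewrite /normal finset.subsetT; apply/fintype.subsetP=> a _; rewrite inE.
by apply/fintype.subsetP=> _ /imsetP[b + ->]; rewrite !inE => /eqP b1; rewrite /= b1 mul1g mulVg.
Qed.

Lemma index_autXY : #|[set: autG] : autXY|%g = #|{: autT (finT L L)}|.
Proof.
have E : autXY = finset.setX [set: autT (finT X X) * autT (finT Y Y)] [set 1%g].
  by apply/setP=> a; rewrite !inE.
have cE : #|autXY| = (#|{: autT (finT X X)}| * #|{: autT (finT Y Y)}|)%N.
  by rewrite E cardsX cards1 muln1 finset.cardsT card_prod.
have /eqP := Lagrange (finset.subsetT autXY); rewrite cE finset.cardsT !card_prod.
rewrite eqn_pmul2l ?muln_gt0; first by move/eqP.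
by rewrite -!finset.cardsT !cardG_gt0.
Qed.

Lemma index_autYL : #|[set: autG] : autYL|%g = #|{: autT (finT X X)}|.
Proof.
have E : autYL = finset.setX (finset.setX [set 1%g] [set: autT (finT Y Y)]) [set: autT (finT L L)].
  by apply/setP=> -[[x y] z]; rewrite !inE /= ?andbT.
have cE : #|autYL| = (#|{: autT (finT Y Y)}| * #|{: autT (finT L L)}|)%N.
  by rewrite E !cardsX cards1 mul1n !finset.cardsT.
have /eqP := Lagrange (finset.subsetT autYL); rewrite cE finset.cardsT !card_prod.
rewrite -[X in _ == X]mulnA [X in _ == X]mulnC eqn_pmul2l ?muln_gt0; first by move/eqP.
by rewrite -!finset.cardsT !cardG_gt0.
Qed.

Lemma Fnum_orbits : Fnum X Y L = #|[set orbit tri_action autXY w | w in triset]|.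
Proof.
apply: (card_orbit_sets (psi := fun t => t : triple)) => [[[f g] h]|w|[[f g] h] t'].
- by split=> [tt|]; rewrite !inE.
- by exists w.
split=> [[xi [xi' [eta [eta' [ixi ieta ->]]]]]|/imsetP[a]].
  (* The action goes through inverses, so [xi] corresponds to the group element whose value is
     [xi']; likewise for [eta]. *)
  have [a [a1 a2]] := inverse_avalV (finT X X) ixi.
  have [b [b1 b2]] := inverse_avalV (finT Y Y) ieta.
  apply/imsetP; exists (a, b, 1%g); first by rewrite inE.
  by rewrite /= /tri_act /= a1 a2 b1 b2 invg1 aval1 comp1m compm1.
rewrite inE => /eqP a1 ->.
exists (aval a.1.1^-1%g), (aval a.1.1), (aval a.1.2^-1%g), (aval a.1.2).
split; [exact: avalV_inverse|exact: avalV_inverse|].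
by rewrite /= /tri_act a1 invg1 /= aval1 comp1m compm1.
Qed.

Lemma aut_scale_inj A : idhom A <> 0 -> injective (aut_scale A).
Proof.
move=> A0 u v /(congr1 (fun a => aval a)) /eqP.
rewrite -subr_eq0 -scalerBl scaler_eq0 => /orP[|/eqP//].
by rewrite subr_eq0 => /eqP/val_inj.
Qed.

Lemma card_scalars : idhom X <> 0 -> #|scalars| = #|k|.-1.
Proof.
move=> X0; rewrite card_injm ?card_finField_unit //.
apply/injmP=> u v _ _ /(congr1 (fun a : autG => a.1.1)).
exact: aut_scale_inj.
Qed.

Lemma autYL_scalars : idhom X <> 0 -> autYL :&: scalars = 1%g.
Proof.
move=> X0; apply/eqP; rewrite finset.eqEsubset sub1G andbT; apply/fintype.subsetP=> a.
rewrite !inE => /andP[/eqP a1 /morphimP[u _ _ ua]]; move: a1; rewrite ua /=.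
have <- : aut_scale X 1%g = 1%g by apply: aval_inj; rewrite mkautK scale1r.
by move/(aut_scale_inj X0) ->; rewrite -[tri_scale _]/(tri_scale_morphism 1%g) morph1.
Qed.

Lemma autXY_scalars : idhom L <> 0 -> autXY :&: scalars = 1%g.
Proof.
move=> L0; apply/eqP; rewrite finset.eqEsubset sub1G andbT; apply/fintype.subsetP=> a.
rewrite !inE => /andP[/eqP a1 /morphimP[u _ _ ua]]; move: a1; rewrite ua /=.
have <- : aut_scale L 1%g = 1%g by apply: aval_inj; rewrite mkautK scale1r.
by move/(aut_scale_inj L0) ->; rewrite -[tri_scale _]/(tri_scale_morphism 1%g) morph1.
Qed.

Lemma aval_act_eq A B (a : autT (finT A A)) (g g' : homk T B A) :
  aval a^-1%g \oc g' = g <-> g' = aval a \oc g.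
Proof.
by split=> [<-|->]; rewrite compmA ?avalKV ?avalVK comp1m.
Qed.

Lemma aval_shact_eq A B (a : autT (finT A A)) (g g' : homk T B (shob A)) :
  shm (aval a^-1%g) \oc g' = g <-> g' = shm (aval a) \oc g.
Proof.
by split=> [<-|->]; rewrite compmA -shm_comp ?avalKV ?avalVK shm_id comp1m.
Qed.

Hypotheses (iX : indecomposable X) (iY : indecomposable Y) (iL : indecomposable L).

Lemma finite_hom_pair A B A' B' : finite_set [set: (homk T A B * homk T A' B')%type].
Proof. by rewrite -setXTT; apply: finite_setX; apply: finT. Qed.

Lemma comp1Dr_eq A B (f : homk T A B) (b : homk T A A) : (f \oc b = f) <-> (f \oc (b - idhom A) = 0).
Proof.
rewrite compBr compm1; split=> [->|/eqP]; first by rewrite subrr.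
by rewrite subr_eq0 => /eqP.
Qed.

Lemma comp1Dl_eq A B (f : homk T A B) (b : homk T B B) : (f = b \oc f) <-> ((b - idhom B) \oc f = 0).
Proof.
rewrite compBl comp1m; split=> [<-|/eqP]; first by rewrite subrr.
by rewrite subr_eq0 => /eqP.
Qed.

Lemma stab_autXY_mod (w : triple) : w.1.1 <> 0 :> homk T Y L -> w.1.2 <> 0 :> homk T L X ->
  (#|'C_autXY[w | tri_action]%g| = 1 %[mod #|k|.-1])%N.
Proof.
case: w => [[f g] h] /= f0 g0.
(* The conditions for (1 + a, 1 + b) to fix the triangle, which are linear in (a, b). *)
pose W : set (homk T X X * homk T Y Y)%type :=
  [set p | [/\ f \oc p.2 = 0, p.1 \oc g = 0 & h \oc p.1 = shm p.2 \oc h]]%classic.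
have sW : subspace W.
  split=> [|a u v [u1 u2 u3] [v1 v2 v3]]; rewrite /W /=.
    by split; rewrite ?linear0 !(comp0l, comp0r).
  by split; rewrite ?linearP !(compDl, compDr) !(compZl, compZr) ?u1 ?u2 ?u3 ?v1 ?v2 ?v3 ?scaler0 ?addr0.
rewrite -(card_subspace_mod (finite_hom_pair X X Y Y) sW); congr (_ %% _)%N.
pose phi (a : autG) : finOf (finite_hom_pair X X Y Y) :=
  (aval a.1.1 - idhom X, aval a.1.2 - idhom Y).
rewrite -(card_in_imset (f := phi)); last first.
  move=> [[a1 a2] a3] [[b1 b2] b3]; rewrite !inE => /andP[/eqP /= -> _] /andP[/eqP /= -> _].
  by case=> /addIr/aval_inj -> /addIr/aval_inj ->.
apply: eq_card => p; rewrite [RHS]inE; apply/imsetP/idP.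
  move=> [[[a1 a2] a3] /setIP[]]; rewrite inE => /eqP /= -> /astab1P.
  rewrite /= /tri_act /= invg1 aval1 comp1m compm1 => -[/comp1Dr_eq e1].
  move=> /aval_act_eq/comp1Dl_eq e2; rewrite -compmA => /aval_shact_eq e3 ->.
  apply/asboolP; split=> //=.
  by rewrite compBr e3 linearB /= shm_id compBl compm1 comp1m.
case: p => a0 b0 /asboolP[/= fb ag hab].
pose a : homk T X X := a0; pose b : homk T Y Y := b0.
(* Since a g = 0 with g nonzero, [a] is not an isomorphism, and locality makes 1 + a one; f b = 0
   with f nonzero gives the same for [b]. *)
have ia : is_isom (idhom X + a).
  by apply: (nonisom_add1 idemT iX (finT X X)) => /isom_cancell /(_ ag).
have ib : is_isom (idhom Y + b).
  by apply: (nonisom_add1 idemT iY (finT Y Y)) => /isom_cancelr /(_ fb).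
have Ka : idhom X + a - idhom X = a by rewrite addrC addKr.
have Kb : idhom Y + b - idhom Y = b by rewrite addrC addKr.
exists (mkaut (finT X X) ia, mkaut (finT Y Y) ib, 1%g); last by rewrite /phi /= !mkautK Ka Kb.
apply/setIP; split; first by rewrite inE.
apply/astab1P; rewrite /= /tri_act /= invg1 aval1 comp1m compm1.
have -> : f \oc aval (mkaut (finT Y Y) ib) = f by apply/comp1Dr_eq; rewrite Kb.
have -> : aval (mkaut (finT X X) ia)^-1%g \oc g = g by apply/aval_act_eq/comp1Dl_eq; rewrite Ka.
congr (_, _); rewrite -compmA; apply/aval_shact_eq.
by rewrite !mkautK compDr linearD compDl /= hab shm_id compm1 comp1m.
Qed.

Lemma stab_autYL_mod (w : triple) : w.1.2 <> 0 :> homk T L X -> w.2 <> 0 :> homk T X (shob Y) ->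
  (#|'C_autYL[w | tri_action]%g| = 1 %[mod #|k|.-1])%N.
Proof.
case: w => [[f g] h] /= g0 h0.
pose W : set (homk T Y Y * homk T L L)%type :=
  [set p | [/\ f \oc p.1 = p.2 \oc f, g \oc p.2 = 0 & shm p.1 \oc h = 0]]%classic.
have sW : subspace W.
  split=> [|a u v [u1 u2 u3] [v1 v2 v3]]; rewrite /W /=.
    by split; rewrite ?linear0 !(comp0l, comp0r).
  by split; rewrite ?linearP !(compDl, compDr) !(compZl, compZr) ?u1 ?u2 ?u3 ?v1 ?v2 ?v3 ?scaler0 ?addr0.
rewrite -(card_subspace_mod (finite_hom_pair Y Y L L) sW); congr (_ %% _)%N.
pose phi (a : autG) : finOf (finite_hom_pair Y Y L L) :=
  (aval a.1.2 - idhom Y, aval a.2 - idhom L).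
rewrite -(card_in_imset (f := phi)); last first.
  move=> [[a1 a2] a3] [[b1 b2] b3]; rewrite !inE => /andP[/eqP /= -> _] /andP[/eqP /= -> _].
  by case=> /addIr/aval_inj -> /addIr/aval_inj ->.
apply: eq_card => p; rewrite [RHS]inE; apply/imsetP/idP.
  move=> [[[a1 a2] a3] /setIP[]]; rewrite inE => /eqP /= -> /astab1P.
  rewrite /= /tri_act /= invg1 aval1 comp1m compm1 => -[].
  rewrite -compmA => /aval_act_eq e1 /comp1Dr_eq e2 /aval_shact_eq/comp1Dl_eq e3 ->.
  apply/asboolP; split=> //=.
    by rewrite compBr compBl e1 compm1 comp1m.
  by rewrite linearB /= shm_id.
case: p => a0 b0 /asboolP[/= fab gb ah].
pose a : homk T Y Y := a0; pose b : homk T L L := b0.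
(* Here the non-isomorphisms come from (T a) h = 0 with h nonzero and from g b = 0 with g
   nonzero. *)
have ia : is_isom (idhom Y + a).
  by apply: (nonisom_add1 idemT iY (finT Y Y)) => /shm_isom/isom_cancell /(_ ah).
have ib : is_isom (idhom L + b).
  by apply: (nonisom_add1 idemT iL (finT L L)) => /isom_cancelr /(_ gb).
have Ka : idhom Y + a - idhom Y = a by rewrite addrC addKr.
have Kb : idhom L + b - idhom L = b by rewrite addrC addKr.
exists (1%g, mkaut (finT Y Y) ia, mkaut (finT L L) ib); last by rewrite /phi /= !mkautK Ka Kb.
apply/setIP; split; first by rewrite inE.
apply/astab1P; rewrite /= /tri_act /= invg1 aval1 comp1m compm1.
have -> : g \oc aval (mkaut (finT L L) ib) = g by apply/comp1Dr_eq; rewrite Kb.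
have -> : shm (aval (mkaut (finT Y Y) ia)^-1%g) \oc h = h.
  by apply/aval_shact_eq/comp1Dl_eq; rewrite mkautK -shm_id -linearB Ka.
congr (_, _, _); rewrite -compmA; apply/aval_act_eq.
by rewrite !mkautK compDr compDl fab compm1 comp1m.
Qed.

Lemma card_autT A : indecomposable A ->
  exists2 a, #|{: autT (finT A A)}| = (#|k|.-1 * a)%N & a = dEnd A %[mod #|k|.-1]%N.
Proof.
move=> iA; have [a ca ma] := card_autom idemT iA (finT A A); exists a => //.
by rewrite -ca card_sig; apply: eq_card => x; rewrite [RHS]inE.
Qed.

Lemma triset_orbit_congr : ~ iso X (shob Y) -> ~ iso Y L ->
  (dEnd X * #|[set orbit tri_action autXY w | w in triset]| =
   dEnd L * #|[set orbit tri_action autYL w | w in triset]| %[mod #|k|.-1])%N.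
Proof.
move=> nXY nYL.
have X0 := indec_id_neq0 idemT iX; have L0 := indec_id_neq0 idemT iL.
have [aX cX mX] := card_autT iX; have [aL cL mL] := card_autT iL.
have cK := card_scalars X0.
(* The factors d(X) and d(L) are replaced by |Aut X| / (q - 1) and |Aut L| / (q - 1), which are the
   indices of [autYL] and [autXY] divided by the number of scalars. *)
rewrite -modnMml -mX modnMml -[in RHS]modnMml -mL modnMml -cK.
apply: (orbit_count_congr autXY_normal autYL_normal (finset.subsetT scalars)
  (autXY_scalars L0) (autYL_scalars X0) tri_acts).
- move=> w _; apply/fintype.subsetP=> _ /morphimP[u _ _ ->].
  by apply/astab1P; apply: tri_scale_fix.
- move=> w; rewrite inE => /asboolP tw; rewrite cK.
  by have [f0 g0] := tri_fg_neq0 idemT iX iY tw nXY; apply: stab_autXY_mod.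
- move=> w; rewrite inE => /asboolP tw; rewrite cK.
  by have [g0 h0] := tri_gh_neq0 idemT iY iL tw nYL; apply: stab_autYL_mod.
- by rewrite index_autXY cL cK.
- by rewrite index_autYL cX cK.
Qed.
End TriangleAction.

(** * Rotation of triangles and its effect on orbits *)

Section Rotation.
Variables (k : finFieldType) (T : triCat k).
Variable (finT : forall X Y : T, finite_set [set: homk T X Y]).
Variables (X Y Z L L' : T).
Variables (u : homk T (shob L') X) (u' : homk T X (shob L')) (iu : inverse_of u u').
Variables (v : homk T (shob Z) L) (v' : homk T L (shob Z)) (iv : inverse_of v v').

Let vv' : v \oc v' = idhom L. Proof. by case: iv. Qed.
Let v'v : v' \oc v = idhom _. Proof. by case: iv. Qed.
Let uu' : u \oc u' = idhom X. Proof. by case: iu. Qed.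
Let u'u : u' \oc u = idhom _. Proof. by case: iu. Qed.

(* Rotating [Z -> L' -> Y -> TZ] twice gives [Y -> TZ -> TL' -> TY]; then [TZ]
   and [TL'] are replaced by [L] and [X]. *)
Definition rotate (t : homk T Z L' * homk T L' Y * homk T Y (shob Z)) : triple finT X Y L :=
  (v \oc t.2, - (u \oc shm t.1.1 \oc v'), - (shm t.1.2 \oc u')).

Lemma rotate_inj : injective rotate.
Proof.
move=> [[f1 g1] h1] [[f2 g2] h2] [Eh /oppr_inj Ef /oppr_inj Eg].
have -> : h1 = h2 by rewrite -(comp1m h1) -v'v -compmA Eh compmA v'v comp1m.
have -> : f1 = f2.
  apply: shm_inj; rewrite -[LHS]comp1m -u'u -[LHS]compm1 -v'v.
  by rewrite -!compmA (compmA u) (compmA (u \oc _)) Ef !compmA u'u comp1m -compmA v'v compm1.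
have -> // : g1 = g2.
by apply: shm_inj; rewrite -[LHS]compm1 -u'u compmA Eg -compmA u'u compm1.
Qed.

Lemma rotate_surj w : exists t, rotate t = w.
Proof.
case: w => [[f g] h].
have [f' Ef] := shm_full (- (u' \oc g \oc v)); have [g' Eg] := shm_full (- (h \oc u)).
exists (f', g', v' \oc f); rewrite /rotate /= Ef Eg compNr !compNl !opprK.
congr (_, _, _); first by rewrite compmA vv' comp1m.
  by rewrite !compmA uu' comp1m -compmA vv' compm1.
by rewrite -compmA uu' compm1.
Qed.

Lemma rotate_exact t : triangles t <-> rotate t \in triset finT X Y L.
Proof.
have iso_v : is_isom v by exists v'.
have iso_v' : is_isom v' by exists v.
have iso_u : is_isom u by exists u'.
have iso_u' : is_isom u' by exists u.
case: t => [[f g] h]; rewrite /triangles /= exact_rot exact_rot inE /rotate.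
split=> [t|/asboolP /= t]; first apply/asboolP => /=.
  refine (exact_iso (id_isom Y) iso_v iso_u _ _ _ t); first by rewrite compm1.
    by rewrite compNr compNl -!compmA v'v compm1.
  by rewrite shm_id comp1m compNl -compmA u'u compm1.
refine (exact_iso (id_isom Y) iso_v' iso_u' _ _ _ t).
- by rewrite compmA v'v comp1m compm1.
- by rewrite compNr compNl !compmA u'u comp1m.
- by rewrite shm_id comp1m compNl.
Qed.

(** Shifting and then conjugating by [v] identifies Aut Z with Aut L, while Aut Y is kept. *)
Lemma rotate_orbit t t' : orbit_of t t' <->
  rotate t' \in orbit (tri_action finT X Y L) (autYL finT X Y L) (rotate t).
Proof.
split.
  move=> [eta [eta' [zeta [zeta' [ieta izeta ->]]]]].
  have [b [b1 b2]] := inverse_avalV (finT Y Y) ieta.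
  have ilam : inverse_of (v \oc shm zeta \oc v') (v \oc shm zeta' \oc v').
    case: izeta => z1 z2; split; rewrite -!compmA (compmA v' v) v'v comp1m;
      by rewrite (compmA (shm _) (shm _)) -shm_comp ?z1 ?z2 shm_id comp1m vv'.
  have [c [c1 c2]] := inverse_avalV (finT L L) ilam.
  apply/imsetP; exists (1%g, b, c); first by rewrite inE.
  rewrite /= /tri_act /rotate /= b1 b2 c1 c2 invg1 aval1 comp1m compm1.
  congr (_, _, _).
  - by rewrite -!compmA (compmA v' v) v'v comp1m.
  - by rewrite compNl shm_comp -!compmA (compmA v' v) v'v comp1m.
  - by rewrite compNr shm_comp compmA.
case/imsetP=> -[[a b] c]; rewrite inE /= => /eqP -> E.
have [z Ez] := shm_full (v' \oc aval c^-1%g \oc v).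
have [z' Ez'] := shm_full (v' \oc aval c \oc v).
have iz : inverse_of z z'.
  split; apply: shm_inj; rewrite shm_comp Ez Ez' shm_id -!compmA (compmA v v') vv' comp1m.
    by rewrite (compmA (aval c)) avalKV comp1m.
  by rewrite (compmA (aval c^-1%g)) avalVK comp1m.
exists (aval b^-1%g), (aval b), z, z'; split=> //; first exact: avalV_inverse.
apply: rotate_inj; rewrite E /rotate /= /tri_act /= invg1 aval1 comp1m compm1.
congr (_, _, _).
- by rewrite Ez !compmA vv' comp1m.
- by rewrite compNl shm_comp Ez' -!compmA vv' compm1.
- by rewrite compNr shm_comp compmA.
Qed.

Lemma Fnum_rotate : Fnum Y Z L' =
  #|[set orbit (tri_action finT X Y L) (autYL finT X Y L) w | w in triset finT X Y L]|.
Proof. exact: (card_orbit_sets rotate_exact rotate_surj rotate_orbit). Qed.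
End Rotation.

Section HallNumberCongruence.
Variables (k : finFieldType) (T : triCat k) (idemT : idempotent_complete T).
Variable (finT : forall X Y : T, finite_set [set: homk T X Y]).

(** Both numbers count orbits on the same set of triangles, the second one after rotation, and d(L)
    = d(TZ) = d(Z). *)
Theorem Fnum_congr (X Y Z L L' : T) :
    indecomposable X -> indecomposable Y -> indecomposable Z ->
    iso L (shob Z) -> iso (shob L') X -> ~ iso X (shob Y) -> ~ iso Y (shob Z) ->
  (dEnd X * Fnum X Y L = dEnd Z * Fnum Y Z L' %[mod #|k|.-1])%N.
Proof.
move=> iX iY iZ LZ [u [u' iu]] nXY nYZ; have [v [v' iv]] := iso_sym LZ.
have iTZ := sh_indec idemT iZ; have iL := iso_indec idemT (iso_sym LZ) iTZ.
rewrite (Fnum_orbits finT) (Fnum_rotate finT Y iu iv).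
rewrite -(dEnd_sh idemT finT iZ) -(dEnd_iso idemT finT iL LZ).
by apply: triset_orbit_congr => // YL; apply: nYZ; apply: iso_trans YL LZ.
Qed.
End HallNumberCongruence.

(** * Grothendieck group, bracket and form *)

Lemma quotpi_eq (V : zmodType) (S : set V) x y : S (x - y) -> quotpi S x = quotpi S y.
Proof.
by move=> Sxy; apply/eqP; rewrite -(Quotient.idealrBE (gen_subgrp S)); apply: mem_gen_subgrp.
Qed.

Lemma quotpiD (V : zmodType) (S : set V) x y :
  quotpi S (x + y) = quotpi S x + quotpi S y.
Proof. exact: raddfD. Qed.

Lemma tensDl (A B : zmodType) (a a' : A) (b : B) : tens (a + a') b = tens a b + tens a' b.
Proof.
rewrite /tens -quotpiD; apply: quotpi_eq; left; exists a, a', b.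
by rewrite opprD addrA.
Qed.

Lemma tensMnl (A B : zmodType) (a : A) (b : B) n : tens (a *+ n) b = tens a b *+ n.
Proof.
elim: n => [|n IHn]; last by rewrite !mulrS tensDl IHn.
by rewrite !mulr0n; apply: (@addrI _ (tens 0 b)); rewrite -tensDl !addr0.
Qed.

Section GrothendieckGroup.
Variables (k : fieldType) (T : triCat k).

Lemma gcls_tri (X Y L : T) (f : homk T Y L) (g : homk T L X) (h : homk T X (shob Y)) :
  exact_tri f g h -> gcls X + gcls Y = gcls L.
Proof.
move=> t; rewrite /gcls -[LHS]quotpiD; apply: quotpi_eq.
by exists X, Y, L, f, g, h.
Qed.

Lemma isocls_iso (X Y : T) : iso X Y -> isocls X = isocls Y.
Proof. by move=> XY; apply/eqmodP/asboolP. Qed.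

Lemma gcls_iso (X Y : T) : iso X Y -> gcls X = gcls Y.
Proof. by rewrite /gcls => /isocls_iso->. Qed.

Lemma formH0r (a : lie_h T) : formH a 0 = 0.
Proof.
rewrite /formH.
suff -> : formQ (subgrp_val a) (subgrp_val (0 : lie_h1 T)) = 0 by rewrite floor0.
(* The chosen form is either biadditive or the zero default. *)
rewrite /formQ; case: xgetP => [b _ [[_ bD] _]|//].
by apply: (@addrI _ (b (subgrp_val a) 0)); rewrite -bD !addr0.
Qed.

Lemma repr_indcls (X : indObj T) : iso (indrepr (indcls X) : T) X.
Proof.
apply/asboolP; have /eqmodP : indcls (indrepr (indcls X)) = indcls X by rewrite /indcls reprK.
by [].
Qed.

Lemma indcls_eq (X Y : indObj T) : iso (X : T) Y <-> indcls X = indcls Y.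
Proof.
split=> [XY|E]; first by apply/eqmodP/asboolP.
by apply: iso_trans (iso_sym (repr_indcls X)) _; rewrite E; apply: repr_indcls.
Qed.

Lemma indreprK (c : indClass T) : indcls (indrepr c) = c.
Proof. exact: reprK. Qed.

Lemma two_periodic_iso (perT : two_periodic T) (X : T) : iso (shob (shob X)) X.
Proof. by case: perT => s [s_iso _]; exists (s X). Qed.

Lemma iter_shob_iso (perT : two_periodic T) n (X : T) :
  iso (iter n shob X) X \/ iso (iter n shob X) (shob X).
Proof.
elim: n => [|n [IHn|IHn]] /=; first by left; apply: iso_refl.
  by right; apply/iso_sh.
by left; apply: iso_trans (two_periodic_iso perT X); apply/iso_sh.
Qed.
End GrothendieckGroup.

(** * Biadditive extensions and coefficients in free abelian groups *)

Section Bilift.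
Variables (I J : choiceType) (phi : I -> J -> int).

Lemma bilift1r (m : {freeg I}) e :
  bilift phi m << e >> = \sum_(i <- dom m) phi i e * coeff i m.
Proof.
rewrite /bilift; apply: eq_bigr => i _; rewrite domU1 big_seq1 coeffU eqxx mulr1.
by rewrite mulrzz.
Qed.

Lemma bilift1l (n : {freeg J}) c :
  bilift phi << c >> n = \sum_(j <- dom n) phi c j * coeff j n.
Proof.
rewrite /bilift domU1 big_seq1; apply: eq_bigr => j _; rewrite coeffU eqxx !mul1r.
by rewrite mulrzz.
Qed.
End Bilift.

Lemma bilift11 (I J : choiceType) (V : zmodType) (phi : I -> J -> V) c e :
  bilift phi << c >> << e >> = phi c e.
Proof. by rewrite /bilift !domU1 !big_seq1 !coeffU !eqxx !mulr1 mulr1z. Qed.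

Lemma sum_dom_pick (K : choiceType) (m : {freeg K}) c :
  \sum_(i <- dom m) ((i == c) : nat)%:Z * coeff i m = coeff c m.
Proof.
have [cm|/coeff_outdom c0] := boolP (c \in dom m).
  rewrite (bigD1_seq c) ?uniq_dom //= eqxx mul1r big1 ?addr0 // => i /negPf->.
  by rewrite mul0r.
by rewrite c0 big1 // => i _; case: eqP => [->|]; rewrite ?c0 ?mulr0 ?mul0r.
Qed.

(** Finiteness of the support matters, because a sum with infinite support is 0 by default. *)
Lemma coeff_fsum (K : choiceType) (F : K -> int) l :
    finite_set [set i | F i <> 0]%classic ->
  coeff l (\sum_(i \in [set: K]) << F i *g i >> : {freeg K}) = F l.
Proof.
move=> fF; have U0 i : << F i *g i >> = 0 :> {freeg K} <-> F i = 0.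
  split=> [/(congr1 (coeff i))|->]; first by rewrite coeffU eqxx mulr1 coeff0.
  by apply/eqP/freeg_eqP => z; rewrite coeffU mul0r coeff0.
case: finite_supportP => [[]|X _ X0 XE].
  by apply: sub_finite_set fF => i [_ /= nz] /U0.
rewrite raddf_sum /=.
have [lX|lX] := boolP (l \in X).
  rewrite (bigD1_seq l) ?fset_uniq //= coeffU eqxx mulr1 big1 ?addr0 // => i /negPf il.
  by rewrite coeffU il mulr0.
have /U0 -> := X0 l I lX.
rewrite big_seq big1 // => i iX; rewrite coeffU; case: eqP => [E|]; last by rewrite mulr0.
by rewrite -E iX in lX.
Qed.

(** * The shift on isomorphism classes and the pairing on n *)

Section ShiftOfClasses.
Variables (k : finFieldType) (T : triCat k) (idemT : idempotent_complete T).
Hypothesis (perT : two_periodic T).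

Definition sh_ind (X : indObj T) : indObj T := IndObj (sh_indec idemT (ind_objP X)).
Definition sh_cls (c : indClass T) : indClass T := indcls (sh_ind (indrepr c)).

Lemma iso_sh_cls (c e : indClass T) :
  iso (indrepr c : T) (shob (indrepr e)) <-> c = sh_cls e.
Proof. by have := indcls_eq (indrepr c) (sh_ind (indrepr e)); rewrite indreprK. Qed.

Lemma iso_shC (X Y : T) : iso X (shob Y) -> iso Y (shob X).
Proof.
move=> XY; apply: iso_trans (iso_sym (two_periodic_iso perT Y)) _.
by apply/iso_sh/iso_sym.
Qed.

Lemma pairing_sym (c e : indClass T) :
  `[< iso (indrepr c : T) (shob (indrepr e)) >] = `[< iso (indrepr e : T) (shob (indrepr c)) >].
Proof. by apply/asboolP/asboolP => /iso_shC. Qed.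

Lemma pairingE (c e : indClass T) :
  `[< iso (indrepr c : T) (shob (indrepr e)) >] = (c == sh_cls e).
Proof. by apply/asboolP/eqP => /iso_sh_cls. Qed.

Lemma pairing1r (m : lie_n T) e :
  bilift (fun c e => (`[< iso (indrepr c : T) (shob (indrepr e)) >] : nat)%:Z) m << e >> =
  coeff (sh_cls e) m.
Proof.
by rewrite bilift1r -sum_dom_pick; apply: eq_bigr => i _; rewrite pairingE.
Qed.

Lemma pairing1l (n : lie_n T) c :
  bilift (fun c e => (`[< iso (indrepr c : T) (shob (indrepr e)) >] : nat)%:Z) << c >> n =
  coeff (sh_cls c) n.
Proof.
rewrite bilift1l -sum_dom_pick; apply: eq_bigr => i _.
by rewrite pairing_sym pairingE.
Qed.
End ShiftOfClasses.

(** * Vanishing and finiteness of the structure constants *)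

Section Bracket.
Variables (k : finFieldType) (T : triCat k) (idemT : idempotent_complete T).
Hypotheses (finT : finitary T) (perT : two_periodic T) (propT : proper_groth T).

Lemma Fnum_neq0 (X Y L : T) : Fnum X Y L <> 0%N -> gcls X + gcls Y = gcls L.
Proof.
move=> F0; have [t tP] : exists t, @triangles k T X Y L t.
  apply: contrapT => H; apply: F0; rewrite /Fnum.
  suff -> : [set orbit_of t | t in @triangles k T X Y L]%classic = set0.
    by rewrite fset_set0 cardfs0.
  by apply/seteqP; split=> // x [t tP _]; case: H; exists t.
exact: gcls_tri tP.
Qed.

(** A triangle would give h_X + h_Y = h_X, against properness. *)
Lemma Fnum_eq0l (X Y L : T) : indecomposable Y -> iso L X -> Fnum X Y L = 0%N.
Proof.
move=> iY LX; apply: contrapT => /Fnum_neq0; rewrite (gcls_iso LX) => E.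
by apply: (propT iY); apply: (@addrI _ (gcls X)); rewrite E addr0.
Qed.

Lemma Fnum_eq0r (X Y L : T) : indecomposable X -> iso L Y -> Fnum X Y L = 0%N.
Proof.
move=> iX LY; apply: contrapT => /Fnum_neq0; rewrite (gcls_iso LY) => E.
by apply: (propT iX); apply: (@addIr _ (gcls Y)); rewrite E add0r.
Qed.

(** Finitarity bounds the classes only up to shift; by 2-periodicity each of the finitely many [S i]
    accounts for at most two classes, its own and that of its shift. *)
Lemma finite_gcls h : finite_set [set c : indClass T | gcls (indrepr c : T) = h].
Proof.
have [N [S SP]] := finT.2 h.
pose B (ib : 'I_N * bool) : set (indClass T) :=
  [set c | iso (indrepr c : T) (if ib.2 then S ib.1 else shob (S ib.1))]%classic.
apply: (@sub_finite_set _ _ (\bigcup_ib B ib)%classic).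
  move=> c /= ch; have [i [a [b ab]]] := SP _ (ind_objP (indrepr c)) ch.
  have cases (U : T) : iso (iter a shob (indrepr c : T)) U ->
      (iso U (S i) \/ iso U (shob (S i))) -> (\bigcup_ib B ib)%classic c.
    move=> cU US.
    have : iso (indrepr c : T) (S i) \/ iso (indrepr c : T) (shob (S i)).
      case: (iter_shob_iso perT a (indrepr c : T)) => /iso_sym/iso_trans/(_ cU) Uc.
        by case: US => US; [left|right]; apply: iso_trans Uc US.
      have {}Uc : iso (indrepr c : T) (shob U).
        by apply: (iso_shC perT); apply: iso_sym.
      case: US => /iso_sh US; [right|left]; apply: iso_trans Uc _ => //.
      exact: iso_trans US (two_periodic_iso perT _).
    by case=> ?; [exists (i, true)|exists (i, false)].
  by apply: cases ab (iter_shob_iso perT b (S i)).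
apply: bigcup_finite => // ib _.
case: (pselect (exists c, B ib c)) => [[c cB]|nB]; last first.
  by apply: (@sub_finite_set _ _ set0) => // c cB; case: nB; exists c.
apply: (@sub_finite_set _ _ [set c]%classic); last exact: finite_set1.
move=> e eB /=; rewrite -(indreprK e) -(indreprK c); apply/indcls_eq.
exact: iso_trans eB (iso_sym cB).
Qed.

Lemma coeff_brk_n (c e l : indClass T) :
  ~ iso (indrepr c : T) (shob (indrepr e)) ->
  coeff l (brk_n c e) = (Fnum (indrepr c : T) (indrepr e) (indrepr l))%:Z
                      - (Fnum (indrepr e : T) (indrepr c) (indrepr l))%:Z.
Proof.
move=> nce; rewrite /brk_n asboolF //.
pose F l : int := (Fnum (indrepr c : T) (indrepr e) (indrepr l))%:Z
                - (Fnum (indrepr e : T) (indrepr c) (indrepr l))%:Z.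
(* A nonzero structure constant fixes the class in the Grothendieck group, so the sum has finite
   support and is not the default 0. *)
have supp l' : F l' <> 0 -> gcls (indrepr l' : T) = gcls (indrepr c : T) + gcls (indrepr e : T).
  move=> F0; have [|] := eqVneq (Fnum (indrepr c : T) (indrepr e) (indrepr l')) 0%N.
    move=> E; have /Fnum_neq0 <- : Fnum (indrepr e : T) (indrepr c) (indrepr l') <> 0%N.
      by move=> E'; apply: F0; rewrite /F E E' subrr.
    by rewrite addrC.
  by move/eqP/Fnum_neq0.
apply: (@coeff_fsum _ F).
exact: sub_finite_set supp (finite_gcls _).
Qed.
End Bracket.

(** * Bracket and form on generators *)

Section BracketOnGenerators.
Variables (k : finFieldType) (T : triCat k) (idemT : idempotent_complete T).
Hypotheses (finT : finitary T) (perT : two_periodic T) (propT : proper_groth T).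

Lemma bilift0l (I J : choiceType) (V : zmodType) (phi : I -> J -> V) n :
  bilift phi 0 n = 0.
Proof. by rewrite /bilift dom0 big_nil. Qed.

Lemma formH0l (b : lie_h1 T) : formH 0 b = 0.
Proof.
rewrite /formH.
suff -> : formQ (subgrp_val (0 : lie_h T)) (subgrp_val b) = 0 by rewrite floor0.
rewrite /formQ; case: xgetP => [f _ [[fD _] _]|//].
by apply: (@addrI _ (f 0 (subgrp_val b))); rewrite -fD !addr0.
Qed.

Lemma h_act0l (m : lie_n T) : h_act 0 m = 0.
Proof.
rewrite /h_act big1 // => c _; rewrite formH0l mul0r.
by apply/eqP/freeg_eqP => z; rewrite coeffU mul0r coeff0.
Qed.

Lemma bracket_u (X Y : indObj T) :
  bracket (u_ X) (u_ Y) = (brk_h (indcls X) (indcls Y), brk_n (indcls X) (indcls Y)).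
Proof. by rewrite /bracket /u_ /= !bilift11 !h_act0l subr0 addr0. Qed.

Lemma bracket_ht (X Y : indObj T) :
  bracket (ht_ X) (u_ Y) =
    (0, - << formH (htilde X) (h1 (indrepr (indcls Y))) *g indcls Y >>).
Proof.
rewrite /bracket /u_ /ht_ /= !bilift0l sub0r h_act0l addr0.
by rewrite /h_act domU1 big_seq1 coeffU eqxx !mulr1.
Qed.

Lemma gform_u1 (x : lie_g T) (Z : indObj T) :
  gform x (u1_ Z) = coeff (sh_cls idemT (indcls Z)) x.2.
Proof. by rewrite /gform /u1_ /= formH0r add0r (pairing1r idemT). Qed.

Lemma gform_u (X : indObj T) (w : lie_g1 T) :
  gform (u_ X) w = coeff (sh_cls idemT (indcls X)) w.2.
Proof. by rewrite /gform /u_ /= formH0l add0r (pairing1l idemT perT). Qed.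

Lemma gform_ht (X : indObj T) (w : lie_g1 T) : gform (ht_ X) w = formH (htilde X) w.1.
Proof. by rewrite /gform /ht_ /= bilift0l addr0. Qed.

Lemma dEnd_repr (X : indObj T) : dEnd (indrepr (indcls X) : T) = dEnd (X : T).
Proof. by apply: (dEnd_iso idemT finT.1 (ind_objP _)); apply: repr_indcls. Qed.

Lemma repr_sh_cls (c : indClass T) : iso (indrepr (sh_cls idemT c) : T) (shob (indrepr c)).
Proof. exact: repr_indcls. Qed.

Lemma brk_iso (c e : indClass T) : iso (indrepr c : T) (shob (indrepr e)) ->
  brk_h c e = htilde (indrepr c) /\ brk_n c e = 0.
Proof. by move=> ce; rewrite /brk_h /brk_n asboolT. Qed.

(** Positivity of d(X) cancels the denominator; this is what brings d(Z)[u_Y, u_Z] into g_1 when Y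
    and TZ are isomorphic. *)
Lemma htilde_dEnd (X : indObj T) : htildeQ X *+ dEnd (X : T) = hQ X.
Proof.
rewrite /htildeQ -tensMnl -[X in tens X _]mulr_natl mulfV // pnatr_eq0 -lt0n.
exact: (dEnd_gt0 idemT (ind_objP X) (finT.1 _ _)).
Qed.

(** By 2-periodicity the hypotheses are symmetric under exchanging X with Z and L with L'; the two
    resulting instances of [Fnum_congr] are combined. *)
Lemma Fnum_diff_congr (X Y Z L L' : T) :
    indecomposable X -> indecomposable Y -> indecomposable Z ->
    iso L (shob Z) -> iso L' (shob X) -> ~ iso X (shob Y) -> ~ iso Y (shob Z) ->
  ((dEnd X)%:Z * ((Fnum X Y L)%:Z - (Fnum Y X L)%:Z) =
   (dEnd Z)%:Z * ((Fnum Y Z L')%:Z - (Fnum Z Y L')%:Z) %[mod (#|k| - 1)%N])%Z.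
Proof.
move=> iX iY iZ LZ L'X nXY nYZ.
have sh2 (A B : T) : iso A (shob B) -> iso (shob A) B.
  by move=> AB; apply: iso_trans (two_periodic_iso perT B); apply/iso_sh.
have E1 := Fnum_congr idemT finT.1 iX iY iZ LZ (sh2 _ _ L'X) nXY nYZ.
have E2 : (dEnd Z * Fnum Z Y L' = dEnd X * Fnum Y X L %[mod #|k|.-1])%N.
  apply: (Fnum_congr idemT finT.1 iZ iY iX L'X (sh2 _ _ LZ)).
    by move=> /(iso_shC perT).
  by move=> /(iso_shC perT).
move: E1 E2; rewrite -subn1.
move=> /(congr1 Posz); rewrite -!modz_nat !PoszM => /eqP; rewrite eqz_mod_dvd => E1.
move=> /(congr1 Posz); rewrite -!modz_nat !PoszM => /eqP; rewrite eqz_mod_dvd => E2.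
apply/eqP; rewrite eqz_mod_dvd; have := rpredD E1 E2.
congr (_ %| _)%Z; ring.
Qed.

Lemma subgrp_valMn (V : zmodType) (S : set V) (a : subgrp S) n :
  subgrp_val (a *+ n) = subgrp_val a *+ n.
Proof. exact: (raddfMn (val : subgrp S -> V)). Qed.

Theorem brk_n_congr (X Y Z : indObj T) :
    ~ iso (indrepr (indcls Y) : T) (shob (indrepr (indcls Z))) ->
  ((dEnd X)%:Z * coeff (sh_cls idemT (indcls Z)) (brk_n (indcls X) (indcls Y)) =
   (dEnd Z)%:Z * coeff (sh_cls idemT (indcls X)) (brk_n (indcls Y) (indcls Z))
     %[mod (#|k| - 1)%N])%Z.
Proof.
rewrite -(dEnd_repr X) -(dEnd_repr Z).
move: (indcls X) (indcls Y) (indcls Z) => x y z nyz.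
have iR c := ind_objP (indrepr c : indObj T).
rewrite (coeff_brk_n finT perT _ nyz).
have [xy|nxy] := pselect (iso (indrepr x : T) (shob (indrepr y))).
  (* When X and TY are isomorphic, the bracket on the left has no component in n; on the right the
     relevant middle term TX is isomorphic to Y, so properness kills both numbers. *)
  have L'Y : iso (indrepr (sh_cls idemT x) : T) (indrepr y).
    apply: iso_trans (repr_sh_cls x) _; apply: iso_sym.
    exact: (iso_shC perT).
  rewrite (brk_iso xy).2 coeff0 (Fnum_eq0l propT) ?(Fnum_eq0r propT) //.
  by rewrite subrr !mulr0.
rewrite (coeff_brk_n finT perT _ nxy).
by apply: Fnum_diff_congr => //; apply: repr_sh_cls.
Qed.

(** The coefficient is taken at TZ, here isomorphic to Y, and by properness Y is not the middle term
    of a triangle with ends X and Y. *)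
Lemma coeff_brk_n_eq0 (x y z : indClass T) :
  iso (indrepr y : T) (shob (indrepr z)) -> coeff (sh_cls idemT z) (brk_n x y) = 0.
Proof.
move=> yz; have [xy|nxy] := pselect (iso (indrepr x : T) (shob (indrepr y))).
  by rewrite (brk_iso xy).2 coeff0.
have LY : iso (indrepr (sh_cls idemT z) : T) (indrepr y).
  by apply: iso_trans (repr_sh_cls z) _; apply: iso_sym.
have iR c := ind_objP (indrepr c : indObj T).
by rewrite (coeff_brk_n finT perT _ nxy) (Fnum_eq0r propT) ?(Fnum_eq0l propT).
Qed.
End BracketOnGenerators.

Theorem mainTheorem13 (k : finFieldType) (T : triCat k)
    (idemT : idempotent_complete T) (finT : finitary T)
    (perT : two_periodic T) (propT : proper_groth T) (X Y Z : indObj T) :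
  (* w is d(Z)[u_Y, u_Z], as an element of g_1 *)
  exists w : lie_g1 T,
    [/\ g1_eq_g w (bracket (u_ Y) (u_ Z) *+ dEnd Z),
        (gform (ht_ X) w = - gform (bracket (ht_ X) (u_ Y)) (u1_ Z)
           %[mod (#|k| - 1)%N])%Z
      & ((dEnd X)%:Z * gform (bracket (u_ X) (u_ Y)) (u1_ Z) = gform (u_ X) w
           %[mod (#|k| - 1)%N])%Z].
Proof.
set y := indrepr (indcls Y); set z := indrepr (indcls Z).
have [yz|nyz] := pselect (iso (y : T) (shob z)).
  (* If Y and TZ are isomorphic then d(Y) = d(Z), so d(Z)[u_Y, u_Z] is h_Y. Both sides of the first
     congruence are then the pairing of the [htilde] of X with h_Y, and both sides of the second are
     0. *)
  exists (h1 y, 0); rewrite !(gform_u1 idemT) gform_ht (gform_u idemT perT).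
  rewrite !bracket_u bracket_ht /= coeffN coeffU.
  rewrite (coeff_brk_n_eq0 idemT finT perT propT _ yz) coeff0 mulr0.
  have /(iso_sh_cls idemT)/eqP -> := yz; rewrite mulr1 opprK.
  split=> //; have [-> ->] := brk_iso yz; split=> /=; last by rewrite raddfMn mul0rn.
  have <- : dEnd (y : T) = dEnd (Z : T).
    rewrite -(dEnd_repr idemT finT Z) -(dEnd_sh idemT finT.1 (ind_objP z)).
    exact: (dEnd_iso idemT finT.1 (ind_objP y) yz).
  by rewrite [X in subgrp_val X](raddfMn fst) subgrp_valMn htilde_dEnd.
(* Otherwise the bracket lies in n: the first congruence reads 0 = 0, as h and n are orthogonal and
   u_Y does not pair with u_Z, and the second is [brk_n_congr]. *)
exists (0, brk_n (indcls Y) (indcls Z) *+ dEnd Z).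
rewrite !(gform_u1 idemT) gform_ht (gform_u idemT perT) !bracket_u bracket_ht /=.
rewrite formH0r coeffN coeffU coeffMn.
have /negPf -> : indcls Y != sh_cls idemT (indcls Z).
  by apply/eqP => /(iso_sh_cls idemT).
rewrite mulr0 !oppr0; split=> //; last by rewrite -mulr_natl natz; apply: brk_n_congr.
split=> /=; last by rewrite raddfMn.
by rewrite /brk_h asboolF // raddfMn /= mul0rn.
Qed.
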